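(* Let $G$ be a locally compact group and let $(G_n)_{n\in \mathbb{N}}$ be an increasing sequence of lattices in $G$ whose union is dense in $G$ (therefore $G$ is unimodular). Let $D$ be a Borel fundamental domain for $G_0$ in $G$, and normalize the Haar measure $\rho$ of $G$ so that $\rho(D)=1$. Let $G\curvearrowright (X,\mu)$ be a measure preserving action on a measured space. Let $f\in L^1(X,\mu)$ be such that, for every $t\in G_0$, $f(tx)=f(x)$ for $\mu$-almost every $x\in X$. Then, for $\mu$-almost every $x\in X$, the function $t\mapsto f(tx)$ is $\rho$-integrable on $D$ and $$\lim_{n\to\infty} \frac{1}{|G_n \cap D|} \sum_{t\in G_n \cap D} f(tx) = \int_D f(tx)\, d\rho(t),$$ where $|G_n\cap D|$ is the cardinality of $G_n\cap D$.
   Context: Locally compact groups are assumed Hausdorff and $\sigma$-compact. A measured space $(X,\mu)$ is a standard Borel space with a non-negative $\sigma$-finite measure $\mu$. An action of $G$ on $(X,\mu)$ is a Borel map $G\times X\to X$, $(t,x)\mapsto tx$, which is a left action; it is measure preserving if $\mu(s^{-1}A)=\mu(A)$ for all $s\in G$ and all Borel $A$. A lattice in $G$ is a discrete subgroup of finite covolume. A Borel fundamental domain for $G_0$ is a Borel set $D\subset G$ such that for every $t\in G$ there is a unique $g\in G_0$ with $gt\in D$. *)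

(* Defs.v *)
From HB Require Import structures.
From mathcomp Require Import all_boot all_order all_algebra.
From mathcomp Require Import all_classical all_reals all_analysis.

Set Implicit Arguments.
Unset Strict Implicit.
Unset Printing Implicit Defensive.

Import Order.TTheory GRing.Theory Num.Theory.
Import numFieldNormedType.Exports.

Local Open Scope classical_set_scope.
Local Open Scope ring_scope.

(* The pointed structure is only there because the library's measurable types
   are pointed; the chosen point plays no role. *)
HB.mixin Record isTopologicalGroup G & PointedTopological G & Group G := {
  mulg_continuous : continuous (fun p : G * G => (p.1 * p.2)%g) ;
  invg_continuous : continuous (fun x : G => x^-1%g) ;
}.

#[short(type="topologicalGroupType")]
HB.structure Definition TopologicalGroup :=
  {G of PointedTopological G & Group G & isTopologicalGroup G}.

(* T with its Borel sigma-algebra *)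
Notation borel T := (g_sigma_algebraType (@open T)).

Definition sigma_compact (T : topologicalType) : Prop :=
  exists K : nat -> set T, (forall n, compact (K n)) /\ \bigcup_n K n = setT.

(* Left Haar measures: nonzero left-invariant Radon measures. Nothing here
   assumes right invariance. *)
Definition haar_measure (R : realType) (G : topologicalGroupType)
    (rho : {measure set (borel G) -> \bar R}) : Prop :=
  [/\ (0 < rho setT)%E,
      forall (s : G) (A : set (borel G)), measurable A ->
        rho [set (s * t)%g | t in A] = rho A,
      forall K : set G, compact K -> (rho K < +oo)%E,
      forall A : set (borel G), measurable A ->
        rho A = ereal_inf [set rho U | U in [set U : set G | open U /\ A `<=` U]]
    & forall U : set G, open U ->
        rho U = ereal_sup [set rho K | K in [set K : set G | compact K /\ K `<=` U]]].

Definition is_subgroup (G : topologicalGroupType) (H : set G) : Prop :=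
  [/\ H 1%g, forall s t, H s -> H t -> H (s * t)%g & forall s, H s -> H s^-1%g].

Definition fundamental_domain (G : topologicalGroupType) (H : set G)
    (D : set (borel G)) : Prop :=
  measurable D /\ forall t : G, exists! g : G, H g /\ D (g * t)%g.

(* The covolume of H is the Haar measure of a Borel fundamental domain, which
   does not depend on the domain. Its finiteness does not depend on the choice
   of the Haar measure rho. *)
Definition is_lattice (R : realType) (G : topologicalGroupType)
    (rho : {measure set (borel G) -> \bar R}) (H : set G) : Prop :=
  [/\ is_subgroup H,
      H `<=` isolated H
    & exists2 F : set (borel G), fundamental_domain H F & (rho F < +oo)%E].

(* A Hausdorff complete pseudometric space is a complete metric space, so T
   below ranges over the Polish spaces. *)
Definition standard_borel (R : realType) d (X : measurableType d) : Prop :=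
  exists T : completePseudoMetricType R,
    [/\ hausdorff_space T,
        exists2 S : set T, countable S & dense S
      & exists (u : X -> borel T) (v : borel T -> X),
          [/\ cancel u v, cancel v u,
              measurable_fun setT u & measurable_fun setT v]].

Definition borel_action (G : topologicalGroupType) d (X : measurableType d)
    (act : G -> X -> X) : Prop :=
  [/\ measurable_fun setT (fun p : borel G * X => act p.1 p.2),
      forall x, act 1%g x = x
    & forall s t x, act (s * t)%g x = act s (act t x)].

(* As act is an action, the preimage of A under act s is s^-1 A. *)
Definition measure_preserving_action (R : realType) (G : topologicalGroupType)
    d (X : measurableType d) (mu : set X -> \bar R) (act : G -> X -> X) : Prop :=
  forall (s : G) (A : set X), measurable A -> mu (act s @^-1` A) = mu A.

(* Main.v *)
Require Import Defs.
From HB Require Import structures.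
From mathcomp Require Import all_boot all_order all_algebra finmap.
From mathcomp Require Import ring lra.
From mathcomp Require Import all_classical all_reals all_analysis.
From mathcomp Require Import measurable_realfun.
Set Implicit Arguments.
Unset Strict Implicit.
Unset Printing Implicit Defensive.
Import Order.TTheory GRing.Theory Num.Theory.
Import numFieldNormedType.Exports HBSimple.
Local Open Scope classical_set_scope.
Local Open Scope ring_scope.

(* Write A_n f for the average of f(t x) over t in G_n `&` D and h(x) for the
   integral of f(t x) over D.  After discarding a null set, f is strictly
   G_0-invariant, so A_n f sums over the cosets of G_0 in G_n; hence it is
   G_n-invariant, and A_n preserves pairings with G_n-invariant functions, as
   a decreasing sequence of conditional expectations does.

   Convergence in L^1: unfolding D along a fundamental domain of G_n shows that
   h(x) is the mean over d in D of (A_n f)(d x).  As (A_n f)(d x) depends only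
   on the coset G_n d, and G_n V fills almost all of D for every neighbourhood
   V of 1 (density of the union), d can be moved into V for most d, where
   f(t d x) - f(t x) is small in L^1 by continuity of translations, uniformly
   over the t with t d in G_0 K for a compact K.

   Convergence almost everywhere: the maximal inequality
     l mu{max_(m <= n <= M) |A_n f - A_M f| > l} <= ||A_m f - A_M f||_1
   upgrades the convergence in L^1. *)

(** * Topological groups and invariant measures *)

(** The measure [mu] may be infinite, and its restriction to the G_n-invariant sets may fail to be
    sigma-finite, so conditional expectations are not at hand. Two of their properties replace them:
    the averages are exactly G_n-invariant, and averaging does not change the integral against a
    bounded G_n-invariant function. The action is only Borel, so continuity of translations has to
    be extracted from measurability. On a set of t of positive Haar measure the preimages t^-1 B of
    a set B of finite measure are nearly constant, and every v near 1 is a quotient b a^-1 of two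
    such t; since a preserves [mu], v^-1 B is close to B. The unfolding compares f at s v x and at s
    x, that is, it moves s v by a right multiplication, whereas continuity in L^1 concerns left
    multiplication by a small element. Passing from one to the other conjugates v by a point k, and
    k v^-1 k^-1 is uniformly small only for k in a compact set. Hence the compact K: by
    G_0-invariance of f it suffices that s v lies in G_0 K. *)

Lemma cvg_mulg (G : topologicalGroupType) (T : Type) (F : set_system T)
    (FF : Filter F) (u v : T -> G) (a b : G) :
  u @ F --> a -> v @ F --> b -> (fun t => (u t * v t)%g) @ F --> (a * b)%g.
Proof.
move=> ua vb.
apply: (@cvg_comp _ _ _ (fun t => (u t, v t)) (fun p : G * G => (p.1 * p.2)%g)
  F (nbhs (a, b)) (nbhs (a * b)%g)).
  exact: cvg_pair.
exact: (@mulg_continuous G (a, b)).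
Qed.

Lemma cvg_invg (G : topologicalGroupType) (T : Type) (F : set_system T)
    (FF : Filter F) (u : T -> G) (a : G) :
  u @ F --> a -> (fun t => (u t)^-1%g) @ F --> a^-1%g.
Proof. by move=> ua; apply: (cvg_comp _ _ ua); exact: invg_continuous. Qed.

Lemma continuous_mulgl (G : topologicalGroupType) (s : G) :
  continuous (fun t => (s * t)%g).
Proof. by move=> t; apply: cvg_mulg; [exact: cvg_cst|exact: cvg_id]. Qed.

Lemma continuous_mulgr (G : topologicalGroupType) (s : G) :
  continuous (fun t => (t * s)%g).
Proof. by move=> t; apply: cvg_mulg; [exact: cvg_id|exact: cvg_cst]. Qed.

Lemma image_mulgl (G : topologicalGroupType) (s : G) (A : set G) :
  [set (s * t)%g | t in A] = (fun t => (s^-1 * t)%g) @^-1` A.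
Proof.
apply/seteqP; split => [_ [t At <-]|t /= At]; first by rewrite /= mulKg.
by exists (s^-1 * t)%g => //; rewrite mulVKg.
Qed.

Lemma image_mulglK (G : topologicalGroupType) (s : G) (A : set G) :
  (fun t => (s * t)%g) @^-1` [set (s * t)%g | t in A] = A.
Proof.
by apply/seteqP; split => [t [u Au /mulgI <-]//|t At /=]; exists t.
Qed.

Lemma measurable_mulgl (G : topologicalGroupType) (s : G) :
  measurable_fun setT (fun t : borel G => (s * t)%g : borel G).
Proof.
apply: (@measurability _ _ (borel G) (borel G) _ _ (@open G)) => //.
move=> _ [B oB <-]; rewrite setTI; apply: sub_sigma_algebra.
by apply: open_comp => // t _; exact: continuous_mulgl.
Qed.

Lemma open_measurable_borel (T : ptopologicalType) (U : set T) :
  open U -> measurable (U : set (borel T)).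
Proof. exact: sub_sigma_algebra. Qed.

Lemma compact_measurable_borel (T : ptopologicalType) (K : set T) :
  hausdorff_space T -> compact K -> measurable (K : set (borel T)).
Proof.
move=> hT /(compact_closed hT) cK; rewrite -[K]setCK.
by apply: measurableC; apply: open_measurable_borel; exact: closed_openC.
Qed.

Lemma measurable_image_mulgl (G : topologicalGroupType) (s : G) (A : set (borel G)) :
  measurable A -> measurable ([set (s * t)%g | t in A] : set (borel G)).
Proof.
by move=> mA; rewrite image_mulgl -[X in measurable X]setTI; exact: measurable_mulgl.
Qed.

(** Two points a, b of [H] near the same x, whether or not x is in [H], have a^-1 b near 1, where
    [H] contains only 1. So each point of [G] has a neighbourhood with at most one point of [H], and
    a compact set contains finitely many. *)
Lemma discrete_subgroup_countable (G : topologicalGroupType) (H : set G) :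
  sigma_compact G -> is_subgroup H -> H `<=` isolated H -> countable H.
Proof.
move=> [K [cK KT]] [H1 HM HV] Hd.
have [_ [V V1 VH]] := Hd _ H1.
have sep x : exists W : set G, [/\ open W, W x & forall a b,
    W a -> W b -> H a -> H b -> a = b].
  have fx : (fun p : G * G => (p.1^-1 * p.2)%g) @ nbhs (x, x) --> (1%g : G).
    rewrite -(mulVg x); apply: cvg_mulg; first by apply: cvg_invg; exact: cvg_fst.
    exact: cvg_snd.
  have [[P Q] /= [Px Qx] PQ] := fx _ V1.
  exists (P `&` Q)^°; split; first exact: open_interior.
    exact: filterI.
  move=> a b /interior_subset[Pa _] /interior_subset[_ Qb] Ha Hb.
  have : (V `&` H) (a^-1 * b)%g by split; [exact: (PQ (a, b))|apply: HM => //; exact: HV].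
  by rewrite VH => /= ab; rewrite -(mulVKg a b) ab mulg1.
have [W WP] := choice sep.
have -> : H = \bigcup_n (H `&` K n).
  by rewrite -setI_bigcupr KT setIT.
apply: bigcup_countable => // n _; apply: finite_set_countable.
have := cK n; rewrite compact_cover => /(_ G setT W).
case=> [i _|x _|E _ KE]; first by case: (WP i).
  by exists x => //; case: (WP x).
apply: (@sub_finite_set _ _ (\bigcup_(i in [set` E]) (H `&` W i))).
  by move=> x [Hx /KE[i Ei Wix]]; exists i.
apply: bigcup_finite => // i _.
have [->|/set0P[a [Ha Wa]]] := eqVneq (H `&` W i) set0; first exact: finite_set0.
apply: (@sub_finite_set _ _ [set a]); last exact: finite_set1.
by move=> b [Hb Wb] /=; case: (WP i) => _ _; exact.
Qed.

Section measure_preserving_maps.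
Context d (X : measurableType d) (R : realType) (mu : {measure set X -> \bar R})
  (T : X -> X).
Hypotheses (mT : measurable_fun setT T)
  (T_preserving : forall A, measurable A -> mu (T @^-1` A) = mu A).

Lemma ge0_integral_preserving (A : set X) (phi : X -> \bar R) :
  measurable A -> measurable_fun A phi -> (forall x, 0 <= phi x)%E ->
  (\int[mu]_(x in T @^-1` A) phi (T x) = \int[mu]_(x in A) phi x)%E.
Proof.
move=> mA mphi phi0.
rewrite -(@ge0_integral_pushforward _ _ _ _ _ _ mT mu A phi)//.
by apply: eq_measure_integral => B mB _; exact: T_preserving.
Qed.

Lemma integral_preserving (A : set X) (phi : X -> \bar R) :
  measurable A -> measurable_fun A phi ->
  (\int[mu]_(x in T @^-1` A) phi (T x) = \int[mu]_(x in A) phi x)%E.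
Proof.
move=> mA mphi; rewrite integralE [RHS]integralE.
rewrite -(@ge0_integral_preserving A phi^\+%E)//; last exact: measurable_funepos.
rewrite -(@ge0_integral_preserving A phi^\-%E)//; last exact: measurable_funeneg.
by congr (_ - _)%E; apply: eq_integral => x _; rewrite ?funeposE ?funenegE.
Qed.

End measure_preserving_maps.

Section haar.
Context (R : realType) (G : topologicalGroupType)
  (rho : {measure set (borel G) -> \bar R}).
Hypothesis rho_haar : haar_measure rho.

Lemma haar_image (s : G) (A : set (borel G)) :
  measurable A -> rho [set (s * t)%g | t in A] = rho A.
Proof. by case: rho_haar => _ + _ _ _; apply. Qed.

Lemma haar_preimage (s : G) (A : set (borel G)) :
  measurable A -> rho ((fun t : borel G => (s * t)%g : borel G) @^-1` A) = rho A.
Proof.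
by move=> mA; rewrite -[in RHS](@haar_image s^-1%g)// image_mulgl invgK.
Qed.

Lemma ge0_integral_mulgl (s : G) (A : set (borel G)) (phi : borel G -> \bar R) :
  measurable A -> measurable_fun setT phi -> (forall t, 0 <= phi t)%E ->
  (\int[rho]_(t in A) phi (s * t)%g = \int[rho]_(t in [set (s * t)%g | t in A]) phi t)%E.
Proof.
move=> mA mphi phi0.
rewrite -[RHS](ge0_integral_preserving (measurable_mulgl s) (@haar_preimage s))//.
- by rewrite (image_mulglK s A).
- exact: measurable_image_mulgl.
- exact: measurable_funTS.
Qed.

Lemma integral_mulgl (s : G) (A : set (borel G)) (phi : borel G -> \bar R) :
  measurable A -> measurable_fun setT phi ->
  (\int[rho]_(t in A) phi (s * t)%g = \int[rho]_(t in [set (s * t)%g | t in A]) phi t)%E.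
Proof.
move=> mA mphi.
rewrite -[RHS](integral_preserving (measurable_mulgl s) (@haar_preimage s))//.
- by rewrite (image_mulglK s A).
- exact: measurable_image_mulgl.
- exact: measurable_funTS.
Qed.

End haar.

(** * Fundamental domains *)

Lemma countable_enum (T : pointedType) (H : set T) (x : T) :
  countable H -> H x -> exists e : nat -> T, range e = H.
Proof.
move=> /pcard_surjP[g Hg] Hx.
exists (fun i => if `[< H (g i) >] then g i else x); apply/seteqP; split.
  by move=> _ [i _ <-]; case: asboolP.
by move=> y Hy; have [i _ giy] := Hg _ Hy; exists i => //; rewrite giy; case: asboolP.
Qed.

Lemma fundamental_domain_inj (G : topologicalGroupType) (H : set G) (D : set (borel G)) :
  is_subgroup H -> fundamental_domain H D ->
  forall g t, H g -> D t -> D (g * t)%g -> g = 1%g.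
Proof.
move=> [H1 _ _] [_ Hu] g t Hg Dt Dgt; have [u [_ uP]] := Hu t.
by rewrite -(uP g)// (uP 1%g)//; split=> //; rewrite mul1g.
Qed.

Lemma fundamental_domain_ex (G : topologicalGroupType) (H : set G) (D : set (borel G)) :
  fundamental_domain H D -> forall t, exists2 g, H g & D (g * t)%g.
Proof. by move=> [_ Hu] t; have [u [[Hut Dut] _]] := Hu t; exists u. Qed.

Section change_of_domain.
Context (R : realType) (G : topologicalGroupType)
  (rho : {measure set (borel G) -> \bar R}).
Hypothesis rho_haar : haar_measure rho.

(** Cut [E] according to the first [e i] that carries the point into [D], and translate each piece
    by its [e i]. The translated pieces lie in [D], and they are disjoint because [E] has at most
    one point in each [H]-orbit. For two fundamental domains the inequality holds both ways. *)
Lemma ge0_le_integral_orbit (H : set G) (E D : set (borel G)) (phi : borel G -> \bar R) :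
  is_subgroup H -> countable H -> measurable E -> measurable D ->
  (forall g t, H g -> E t -> E (g * t)%g -> g = 1%g) ->
  (forall t, E t -> exists2 g, H g & D (g * t)%g) ->
  measurable_fun setT phi -> (forall t, 0 <= phi t)%E ->
  (forall g t, H g -> phi (g * t)%g = phi t) ->
  (\int[rho]_(t in E) phi t <= \int[rho]_(t in D) phi t)%E.
Proof.
move=> [H1 HM HV] cH mE mD Einj Dex mphi phi0 phiH.
have [e eH] := countable_enum cH H1.
have He i : H (e i) by rewrite -eH; exists i.
pose E_ i : set (borel G) := E `&` (fun t => (e i * t)%g) @^-1` D.
have mE_ i : measurable (E_ i).
  by apply: measurableI => //; rewrite -[X in measurable X]setTI; exact: measurable_mulgl.
pose F := seqDU E_.
have mF i : measurable (F i) by exact: seqDU_measurable.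
have tF : trivIset setT F by exact: trivIset_seqDU.
have EF : E = \bigcup_i F i.
  rewrite -seqDU_bigcup_eq; apply/seteqP; split => [t Et|t [i _ []]//].
  by have [g Hg Dg] := Dex t Et; move: Hg Dg; rewrite -eH => -[i _ <-] ?; exists i.
pose eF i : set (borel G) := [set (e i * t)%g | t in F i].
have meF i : measurable (eF i) by exact: measurable_image_mulgl.
have FE i t : F i t -> E_ i t by exact: subset_seqDU.
have teF : trivIset setT eF.
  apply/trivIsetP => i j _ _ ij; apply/seteqP; split => // _ [[t Ft <-] [u Fu eut]].
  have [Et _] := FE _ _ Ft; have [Eu _] := FE _ _ Fu.
  have ut : u = ((e j)^-1 * e i * t)%g by rewrite -mulgA -eut mulKg.
  have g1 : ((e j)^-1 * e i)%g = 1%g.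
    by apply: (Einj _ t) => //; [apply: HM => //; exact: HV|rewrite -ut].
  move: ut; rewrite g1 mul1g => ut; rewrite ut in Fu.
  have /trivIsetP/(_ i j Logic.I Logic.I ij) := tF.
  by apply/eqP/set0P; exists t.
rewrite [in leLHS]EF ge0_integral_bigcup//=; last exact: measurable_funTS.
rewrite [leLHS](_ : _ = (\sum_(0 <= i <oo) \int[rho]_(t in eF i) phi t)%E); last first.
  apply: eq_eseriesr => i _; rewrite -ge0_integral_mulgl//.
  by apply: eq_integral => t _; rewrite phiH.
rewrite -ge0_integral_bigcup//=; last exact: measurable_funTS.
apply: ge0_subset_integral => //; first exact: bigcupT_measurable.
  exact: measurable_funTS.
by move=> _ [i _ [t /FE[_ Dt] <-]].
Qed.

Lemma ge0_integral_fundamental_domain (H : set G) (E D : set (borel G))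
    (phi : borel G -> \bar R) :
  is_subgroup H -> countable H -> fundamental_domain H E -> fundamental_domain H D ->
  measurable_fun setT phi -> (forall t, 0 <= phi t)%E ->
  (forall g t, H g -> phi (g * t)%g = phi t) ->
  (\int[rho]_(t in E) phi t = \int[rho]_(t in D) phi t)%E.
Proof.
move=> gH cH fE fD mphi phi0 phiH; apply/eqP; rewrite eq_le.
have [[mE _] [mD _]] := (fE, fD).
apply/andP; split; apply: (ge0_le_integral_orbit gH cH) => //.
- exact: fundamental_domain_inj.
- by move=> t _; exact: fundamental_domain_ex.
- exact: fundamental_domain_inj.
- by move=> t _; exact: fundamental_domain_ex.
Qed.

End change_of_domain.

Lemma sume_const_seq (R : realType) (I : Type) (r : seq I) (x : \bar R) :
  (\sum_(i <- r) x = (size r)%:R%:E * x)%E.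
Proof. by rewrite big_const_seq count_predT iter_addr addr0 mule_natl. Qed.

(** * Points of a larger lattice in [D], and unfolding of integrals over [D] *)

Section nested_lattices.
Context (R : realType) (G : topologicalGroupType)
  (rho : {measure set (borel G) -> \bar R}).
Hypothesis rho_haar : haar_measure rho.
Context (H L : set G) (D F : set (borel G)).
Hypotheses (gH : is_subgroup H) (gL : is_subgroup L) (HL : H `<=` L)
  (cH : countable H) (cL : countable L).
Hypotheses (fD : fundamental_domain H D) (fF : fundamental_domain L F).

(** With [A] listing the points of [L] in [D], this is a second fundamental domain for [H]. It is
    set up for arbitrary finite lists because it also serves to prove that there are finitely many
    such points. *)
Let translates (A : seq G) : set (borel G) :=
  \big[setU/set0]_(t <- A) [set (t * d)%g | d in F].

Let mF : measurable F. Proof. by case: fF. Qed.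
Let mD : measurable D. Proof. by case: fD. Qed.

Let translatesP (A : seq G) s :
  translates A s <-> exists2 t, t \in A & exists2 d, F d & (t * d)%g = s.
Proof. by rewrite /translates -bigcup_seq. Qed.

Let measurable_translates (A : seq G) : measurable (translates A).
Proof. by apply: bigsetU_measurable => t _; exact: measurable_image_mulgl. Qed.

(** Countably many translates of [F] cover [G], which is not null. *)
Lemma fundamental_domain_pos : (0 < rho F)%E.
Proof.
have [G0 _ _ _ _] := rho_haar.
have [L1 LM LV] := gL.
rewrite lt0e measure_ge0 andbT; apply/eqP => F0.
have [e eL] := countable_enum cL L1.
have : rho.-negligible (\bigcup_i [set (e i * t)%g | t in F]).
  apply: negligible_bigcup => i; apply/negligibleP.
    exact: measurable_image_mulgl.
  exact: etrans (haar_image rho_haar _ mF) F0.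
rewrite (_ : \bigcup_i _ = setT).
  by move/negligibleP => /(_ measurableT) GT; move: G0; rewrite GT ltxx.
apply/seteqP; split => // t _; have [g Lg Fg] := fundamental_domain_ex fF t.
move/LV: Lg; rewrite -eL => -[i _ eig]; exists i => //.
by exists (g * t)%g => //; rewrite eig mulKg.
Qed.

Let trivIset_translates (A : set G) : A `<=` L ->
  trivIset A (fun t : G => [set (t * d)%g | d in F]).
Proof.
have [L1 LM LV] := gL.
move=> AL t u At Au [_ [[d Fd <-] [d' Fd' tud]]].
have dE : d = (t^-1 * u * d')%g by rewrite -mulgA tud mulKg.
have tu1 : (t^-1 * u)%g = 1%g.
  apply: (fundamental_domain_inj gL fF (t := d')) => //; last by rewrite -dE.
  by apply: LM; [apply: LV; exact: AL|exact: AL].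
by apply: (@mulgI _ t^-1%g); rewrite mulVg tu1.
Qed.

Lemma ge0_integral_translates (A : {fset G}) (phi : borel G -> \bar R) :
  [set` A] `<=` L -> measurable_fun setT phi -> (forall t, 0 <= phi t)%E ->
  (\int[rho]_(t in translates A) phi t =
   \sum_(t <- A) \int[rho]_(d in F) phi (t * d)%g)%E.
Proof.
move=> AL mphi phi0.
rewrite ge0_integral_bigsetU//=.
- by apply: eq_bigr => t _; rewrite ge0_integral_mulgl.
- by move=> t; exact: measurable_image_mulgl.
- exact: fset_uniq.
- exact: trivIset_translates.
- exact: measurable_funTS.
Qed.

(** If g t d = u d' with d, d' in [F], then u^-1 g t belongs to [L] and carries d to d', so it is 1.
    Now g t = u lies in [D] together with t, which forces g = 1. *)
Let translates_inj (A : seq G) : [set` A] `<=` L `&` D ->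
  forall g t, H g -> translates A t -> translates A (g * t)%g -> g = 1%g.
Proof.
have [L1 LM LV] := gL.
move=> AL g s Hg /translatesP[t tA [d Fd <-]] /translatesP[u uA [d' Fd' ud']].
have [[Lt Dt] [Lu Du]] := (AL _ tA, AL _ uA).
have d'E : d' = (u^-1 * g * t * d)%g by rewrite -(mulKg u d') ud' !mulgA.
have e1 : (u^-1 * g * t)%g = 1%g.
  apply: (fundamental_domain_inj gL fF (t := d)) => //; last by rewrite -d'E.
  by apply: (LM) => //; apply: (LM); [exact: LV|exact: HL].
apply: (fundamental_domain_inj gH fD (t := t)) => //.
suff -> : (g * t)%g = u by [].
by apply: (@mulgI _ u^-1%g); rewrite mulgA e1 mulVg.
Qed.

(** The translates of [F] by a finite set [A] of such points meet each [H]-orbit at most once, so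
    their total measure, #|A| times [rho F], is at most [rho D]. As [rho F] is positive, this bounds
    #|A|. *)
Lemma finite_lattice_points : (rho D < +oo)%E -> finite_set (L `&` D).
Proof.
move=> Dfin; apply: contrapT => /infinite_set_fset infS.
have Fpos := fundamental_domain_pos.
have key (A : {fset G}) : [set` A] `<=` L `&` D -> (#|` A|%:R%:E * rho F <= rho D)%E.
  move=> AS; have AL : [set` A] `<=` L by move=> t /AS[].
  have := ge0_le_integral_orbit rho_haar gH cH (measurable_translates A) mD
    (translates_inj AS) (fun t _ => fundamental_domain_ex fD t)
    (phi := cst 1%E) (measurable_cst _) (fun=> lee01) (fun _ _ _ => erefl).
  rewrite [leRHS]integral_cst// mul1e ge0_integral_translates//.
  by under eq_bigr do rewrite integral_cst// mul1e; rewrite sume_const_seq.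
move: Fpos key; case: (rho F) => [r|_|//]; last first.
  (* When [rho F] is infinite, a single point already contradicts the finiteness of [rho D]. *)
  move=> key; have [A AS A1] := infS 1%N.
  move: (key A AS); rewrite gt0_muley ?lte_fin ?ltr0n//.
  by rewrite leye_eq => /eqP rhoD; rewrite rhoD in Dfin.
rewrite lte_fin => r0 key; have D0 : (0 <= rho D)%E by exact: measure_ge0.
move: D0 Dfin key; case: (rho D) => [s|//|//]; rewrite lee_fin => s0 _ key.
have [A AS ltA] := infS (Num.truncn (s / r)).+1.
have := key A AS; rewrite lee_fin -ler_pdivlMr// => As.
move: ltA; rewrite ltnNge => /negP; apply.
by rewrite truncn_ge_nat// divr_ge0// ltW.
Qed.

Hypothesis D_finite : (rho D < +oo)%E.
Let S := fset_set (L `&` D).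

Let mem_S t : t \in S <-> L t /\ D t.
Proof. by rewrite in_fset_set ?inE//; exact: finite_lattice_points. Qed.

Let SL : [set` S] `<=` L. Proof. by move=> t /= /mem_S[]. Qed.

Lemma fundamental_domain_translates : fundamental_domain H (translates S).
Proof.
have [H1 HM HV] := gH; have [L1 LM LV] := gL.
split=> // s; have [l Ll Fls] := fundamental_domain_ex fF s.
(* Bringing l^-1 into [D] splits h s as h l^-1, a point of [L] in [D], times l s, a point of [F]. *)
have [h Hh Dhl] := fundamental_domain_ex fD l^-1%g.
have hsE : (h * s = (h * l^-1) * (l * s))%g by rewrite mulgA mulgVK.
have Shs : translates S (h * s)%g.
  apply/translatesP; exists (h * l^-1)%g; last by exists (l * s)%g.
  by apply/mem_S; split=> //; apply: (LM); [exact: HL|exact: LV].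
exists h; split => // h' [Hh' Sh's].
have : (h * h'^-1)%g = 1%g.
  apply: (translates_inj (A := S) _ (t := (h' * s)%g)) => //.
  - by move=> t /= /mem_S.
  - by apply: (HM) => //; exact: HV.
  - by rewrite mulgA mulgVK.
by move=> hh'; apply: (@mulIg _ h'^-1%g); rewrite hh' mulgV.
Qed.

Lemma ge0_integral_unfold (phi : borel G -> \bar R) :
  measurable_fun setT phi -> (forall t, 0 <= phi t)%E ->
  (forall g t, H g -> phi (g * t)%g = phi t) ->
  (\int[rho]_(t in D) phi t =
   \int[rho]_(d in F) \sum_(t <- S) phi (t * d)%g)%E.
Proof.
move=> mphi phi0 phiH.
rewrite (ge0_integral_fundamental_domain rho_haar gH cH fD fundamental_domain_translates)//.
rewrite ge0_integral_translates// ge0_integral_sum// => t.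
by apply: measurable_funTS; apply: (measurableT_comp mphi); exact: measurable_mulgl.
Qed.

Lemma integral_unfold (phi : borel G -> R) :
  measurable_fun setT phi -> rho.-integrable D (EFin \o phi) ->
  (forall g t, H g -> phi (g * t)%g = phi t) ->
  rho.-integrable F (fun d => (\sum_(t <- S) phi (t * d)%g)%:E) /\
  (\int[rho]_(t in D) (phi t)%:E =
   \int[rho]_(d in F) (\sum_(t <- S) phi (t * d)%g)%:E)%E.
Proof.
move=> mphi iphi phiH.
have mephi : measurable_fun setT (EFin \o phi) by exact/measurable_EFinP.
have mt t : measurable_fun setT (fun d : borel G => phi (t * d)%g).
  by apply: (measurableT_comp mphi); exact: measurable_mulgl.
have mabs : measurable_fun setT (fun s : borel G => `|(phi s)%:E|%E).
  exact: (measurableT_comp (@abse_measurable _ setT) mephi).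
have mabst t : measurable_fun setT (fun d : borel G => `|(phi (t * d)%g)%:E|%E).
  by apply: (measurableT_comp mabs); exact: measurable_mulgl.
have isum t : t \in S -> rho.-integrable F (fun d => (phi (t * d)%g)%:E).
  move=> tS; apply/integrableP; split.
    by apply: measurable_funTS; exact/measurable_EFinP.
  have /integrableP[_] := iphi; apply: le_lt_trans.
  rewrite (ge0_integral_unfold (phi := fun t => `|(phi t)%:E|%E))//=.
  - apply: ge0_le_integral => //=.
    + by apply: measurable_funTS; exact: mabst.
    + by apply: measurable_funTS; apply: emeasurable_sum => u; exact: mabst.
    + move=> d _; rewrite (big_fsetD1 t)//= leeDl//.
      by apply: sume_ge0 => u _; rewrite lee_fin.
  - by move=> g s Hg; rewrite phiH.
have isumS : rho.-integrable F (fun d => (\sum_(t <- S) phi (t * d)%g)%:E).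
  under eq_fun do rewrite -sumEFin big_seq.
  exact: integrable_sum.
split => //; have [mT _] := fundamental_domain_translates.
have mphip : measurable_fun setT (EFin \o phi)^\+%E by exact: measurable_funepos.
have mphin : measurable_fun setT (EFin \o phi)^\-%E by exact: measurable_funeneg.
have DT : (\int[rho]_(t in D) (phi t)%:E = \int[rho]_(t in translates S) (phi t)%:E)%E.
  rewrite integralE [RHS]integralE; congr (_ - _)%E;
    apply: (ge0_integral_fundamental_domain rho_haar gH cH fD fundamental_domain_translates) => //.
  - by move=> g t Hg; rewrite !funeposE /= phiH.
  - by move=> g t Hg; rewrite !funenegE /= phiH.
rewrite DT integral_bigsetU_EFin//=.
- rewrite big_seq; under eq_bigr => t tS do rewrite -integral_mulgl//.
  rewrite -big_seq.
  (* [integral_sum] asks for integrability of the summands at every index, but [isum] gives it only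
     for [t] in [S]; the others are replaced by 0. *)
  transitivity (\int[rho]_(d in F)
    \sum_(t <- S) (if t \in S then (phi (t * d)%g)%:E else 0))%E; last first.
    apply: eq_integral => d _; rewrite -sumEFin big_seq [RHS]big_seq.
    by apply: eq_bigr => t ->.
  rewrite integral_sum//; last first.
    by move=> t; case: (boolP (t \in S)) => [/isum//|_]; exact: integrable0.
  rewrite big_seq [RHS]big_seq; apply: eq_bigr => t tS.
  by apply: eq_integral => d _; rewrite tS.
- by move=> t; exact: measurable_image_mulgl.
- exact: fset_uniq.
- exact: trivIset_translates.
- exact: measurable_funTS.
Qed.

Lemma lattice_points_measure : ((size S)%:R%:E * rho F = rho D)%E.
Proof.
have := ge0_integral_unfold (phi := cst 1%E) (measurable_cst _) (fun=> lee01) (fun _ _ _ => erefl).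
rewrite integral_cst// mul1e => ->.
under eq_integral do rewrite sume_const_seq mule1.
by rewrite integral_cst.
Qed.

(* Right multiplication by an element of L permutes the cosets of H in L. *)
Lemma sum_lattice_points_mulgr (V : nmodType) (c : G -> V) (l : G) : L l ->
  (forall g t, H g -> c (g * t)%g = c t) ->
  \sum_(t <- S) c (t * l)%g = \sum_(t <- S) c t.
Proof.
move=> Ll cH'; have [H1 HM HV] := gH; have [L1 LM LV] := gL.
have /choice[g gP] : forall t, exists g, H g /\ D (g * t)%g.
  by move=> t; have [g Hg Dg] := fundamental_domain_ex fD t; exists g.
pose r l t := (g (t * l) * (t * l))%g.
have rS k t : L k -> t \in S -> r k t \in S.
  move=> Lk /mem_S[Lt Dt]; apply/mem_S; split; last by case: (gP (t * k)%g).
  by apply: (LM); [apply: HL; case: (gP (t * k)%g)|exact: LM].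
have rK k t : L k -> t \in S -> r k^-1%g (r k t) = t.
  move=> Lk tS; have [Lt Dt] := (mem_S t).1 tS.
  have E : (r k t * k^-1 = g (t * k) * t)%g by rewrite /r -!mulgA mulgV mulg1.
  rewrite {1}/r E mulgA.
  set u := (g _ * g _)%g; suff -> : u = 1%g by rewrite mul1g.
  apply: (fundamental_domain_inj gH fD (t := t)) => //.
    by apply: (HM); [case: (gP (g (t * k) * t)%g)|case: (gP (t * k)%g)].
  by rewrite /u -mulgA; case: (gP (g (t * k) * t)%g).
have permS : perm_eq [seq r l t | t <- S] S.
  apply: uniq_perm; [|exact: fset_uniq|].
    rewrite map_inj_in_uniq ?fset_uniq// => t u tS uS rtu.
    by rewrite -(rK l t)// -(rK l u)// rtu.
  move=> u; apply/mapP/idP => [[t tS ->]|uS]; first exact: rS.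
  exists (r l^-1%g u); first by apply: rS => //; exact: LV.
  by rewrite -{1}(rK l^-1%g u (LV _ Ll) uS) invgK.
rewrite -[RHS](perm_big _ permS)/= big_map; apply: eq_bigr => t _.
by rewrite /r cH'//; case: (gP (t * l)%g).
Qed.

End nested_lattices.

(** * Continuity of translations in L^1 *)

(** The point k v^-1 is obtained from k by left multiplication by k v^-1 k^-1. This tends to 1 with
    v for each k, and compactness makes the neighbourhood of v uniform over [K]. *)
Lemma near_conjg (G : topologicalGroupType) (K : set G) (P : set G) :
  compact K -> nbhs (1%g : G) P ->
  \forall v \near (1%g : G), forall k, K k -> P (k * v^-1 * k^-1)%g.
Proof.
move=> cK P1; have /compact_near_coveringP nK := cK.
apply: (nK G (nbhs (1%g : G)) (fun v k => P (k * v^-1 * k^-1)%g)) => x _.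
have : (fun p : G * G => (p.1 * p.2^-1 * p.1^-1)%g) @ nbhs (x, 1%g) --> (1%g : G).
  rewrite -[X in _ --> X](mulgV x) -[X in (X * _)%g]mulg1 -[X in (_ * X * _)%g]invg1.
  apply: cvg_mulg; last by apply: cvg_invg; exact: cvg_fst.
  by apply: cvg_mulg; [exact: cvg_fst|apply: cvg_invg; exact: cvg_snd].
by move=> /(_ _ P1).
Qed.

(** * A Steinhaus theorem for Haar measure *)

Section steinhaus.
Context (R : realType) (G : topologicalGroupType)
  (rho : {measure set (borel G) -> \bar R}).
Hypotheses (hG : hausdorff_space G) (sG : sigma_compact G)
  (rho_haar : haar_measure rho).

Lemma haar_compact_subset_pos (E : set (borel G)) : measurable E -> (0 < rho E)%E ->
  exists2 E' : set (borel G), measurable E' /\ E' `<=` E & (0 < rho E' < +oo)%E.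
Proof.
move=> mE E0; have [K [cK KT]] := sG; have [_ _ Kfin _ _] := rho_haar.
have mK n : measurable (K n : set (borel G)) by exact: compact_measurable_borel.
apply: contrapT => nE.
have : rho.-negligible (\bigcup_n (E `&` K n)).
  apply: negligible_bigcup => n; apply/negligibleP; first exact: measurableI.
  apply: contrapT => /eqP EK; apply: nE; exists (E `&` K n).
    by split; [exact: measurableI|exact: subIsetl].
  rewrite lt0e EK measure_ge0/=; apply: le_lt_trans (Kfin _ (cK n)).
  by apply: le_measure; rewrite ?inE//; exact: measurableI.
rewrite -setI_bigcupr KT setIT => /negligibleP => /(_ mE) EE.
by move: E0; rewrite EE ltxx.
Qed.

(** Inner regularity is available only for open sets, so the compact [K] approximates an open U
    around [E'], and not [E'] itself. Both approximations are within r / 3, where r = [rho E']. If v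
    K is inside U and v (E' [&] K) misses [E'], then U contains disjoint sets of measure more than
    2r / 3 and equal to r, although its measure is below 4r / 3. *)
Lemma steinhaus (E : set (borel G)) : measurable E -> (0 < rho E)%E ->
  \forall v \near (1%g : G), exists a b : G, [/\ E a, E b & (v * a)%g = b].
Proof.
move=> mE0 /(haar_compact_subset_pos mE0)[E' [mE E'E] /andP[Epos Efin]].
suff : \forall v \near (1%g : G), exists a b : G, [/\ E' a, E' b & (v * a)%g = b].
  by apply: filterS => v [a [b [/E'E ? /E'E ? ?]]]; exists a, b.
have [_ _ Kfin outer inner] := rho_haar.
have E_fin : rho E' \is a fin_num by rewrite ge0_fin_numE// ltW.
pose r := fine (rho E'); have rE : rho E' = r%:E by rewrite fineK.
have r0 : 0 < r by rewrite -lte_fin -rE.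
have d0 : 0 < r / 3 by rewrite divr_gt0.
pose outs : set (\bar R) := [set rho U | U in [set U : set G | open U /\ E' `<=` U]].
have Einf : ereal_inf outs = r%:E.
  by rewrite -rE; exact/esym/(outer _ mE).
have Ifin : ereal_inf outs \is a fin_num by rewrite Einf.
have [_ [U [oU EU] <-]] := lb_ereal_inf_adherent d0 Ifin.
rewrite Einf -EFinD => Ur.
have mU : measurable (U : set (borel G)) by exact: open_measurable_borel.
have U_fin : rho U \is a fin_num by rewrite ge0_fin_numE// (lt_trans Ur)// ltry.
pose u := fine (rho U); have uE : rho U = u%:E by rewrite fineK.
pose ins : set (\bar R) := [set rho K | K in [set K : set G | compact K /\ K `<=` U]].
have Usup : ereal_sup ins = u%:E.
  by rewrite -uE; exact/esym/(inner _ oU).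
have Sfin : ereal_sup ins \is a fin_num by rewrite Usup.
have [_ [K [cK KU] <-]] := ub_ereal_sup_adherent d0 Sfin.
rewrite Usup -EFinB => UK.
have mK : measurable (K : set (borel G)) by exact: compact_measurable_borel.
have K_fin : rho K \is a fin_num by rewrite ge0_fin_numE// Kfin.
have near_KU : \forall v \near (1%g : G), K `<=` (fun k => U (v * k)%g).
  have /compact_near_coveringP nK := cK.
  apply: (nK G (nbhs (1%g : G)) (fun v k => U (v * k)%g)) => x Kx.
  have : (fun p : G * G => (p.2 * p.1)%g) @ nbhs (x, 1%g) --> x.
    rewrite -[X in _ --> X](mul1g x).
    by apply: cvg_mulg; [exact: cvg_snd|exact: cvg_fst].
  by apply; apply: open_nbhs_nbhs; split => //; exact: KU.
apply: filterS near_KU => v vKU; apply: contrapT => nab.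
pose B : set (borel G) := E' `&` K.
have mB : measurable B by exact: measurableI.
pose vB : set (borel G) := [set (v * t)%g | t in B].
have mvB : measurable vB by exact: measurable_image_mulgl.
have vB_E : [disjoint vB & E'].
  apply/disj_setPS => w [[t [Et Kt] vtw] Ew]; rewrite -vtw in Ew.
  by apply: nab; exists t, (v * t)%g.
have vBE : (rho (vB `|` E') = rho vB + rho E')%E.
  by apply: measureU => //; exact/eqP.
have vBE_U : (rho (vB `|` E') <= rho U)%E.
  apply: le_measure; rewrite ?inE//; first exact: measurableU.
  by move=> w [[t [Et Kt] <-]|/EU//]; exact: vKU.
have vB_B : rho vB = rho B by exact: (haar_image rho_haar).
have B_fin : rho B \is a fin_num.
  rewrite ge0_fin_numE//; apply: le_lt_trans Efin.
  by apply: le_measure; rewrite ?inE//; exact: subIsetl.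
have UDK : (rho (U `\` K) = rho U - rho K)%E.
  rewrite -[in RHS](setIidr KU); apply: measureD => //.
  by rewrite ltey_eq U_fin.
have EB : (rho E' = rho (E' `\` K) + rho B)%E by exact: measureDI.
have EK : (rho (E' `\` K) <= rho (U `\` K))%E.
  apply: le_measure; rewrite ?inE; [exact: measurableD|exact: measurableD|].
  exact: setSD.
have EK_fin : rho (E' `\` K) \is a fin_num.
  rewrite ge0_fin_numE//; apply: le_lt_trans EK _.
  by rewrite UDK ltey_eq fin_numB U_fin K_fin.
move: vBE_U EK EB; rewrite vBE vB_B UDK rE uE.
rewrite -(fineK B_fin) -(fineK K_fin) -(fineK EK_fin) -!EFinD !lee_fin => h1 h2 [h3].
move: UK Ur; rewrite -(fineK K_fin) uE !lte_fin => h4 h5.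
by clear -h1 h2 h3 h4 h5 r0; lra.
Qed.

End steinhaus.

Lemma measure_bigcup_pos d (T : measurableType d) (R : realType)
    (m : {measure set T -> \bar R}) (E : set T) (F : nat -> set T) :
  (forall n, measurable (F n)) -> measurable E -> (0 < m E)%E -> E `<=` \bigcup_n F n ->
  exists n, (0 < m (F n))%E.
Proof.
move=> mF mE E0 EF; apply: contrapT => nF.
have /(negligibleS EF)/negligibleP : m.-negligible (\bigcup_n F n).
  apply: negligible_bigcup => n; apply/negligibleP => //.
  by apply/eqP; rewrite -measure_le0 leNgt; apply/negP => ?; apply: nF; exists n.
by move=> /(_ mE) Ez; rewrite Ez ltxx in E0.
Qed.

Lemma measure_subU_lt d (X : measurableType d) (R : realType) (nu : {measure set X -> \bar R})
    (A B C : set X) (e : R) : measurable A -> measurable B -> measurable C ->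
  A `<=` B `|` C -> (nu B < (e / 2)%:E)%E -> (nu C < (e / 2)%:E)%E -> (nu A < e%:E)%E.
Proof.
move=> mA mB mC ABC nB nC; apply: (@le_lt_trans _ _ (nu (B `|` C))).
  by apply: le_measure; rewrite ?inE//; exact: measurableU.
apply: (@le_lt_trans _ _ (nu B + nu C)%E); first exact: measureU2.
by rewrite [e]splitr EFinD lteD.
Qed.

(** * Near constancy of the sections of a measurable subset of a product *)

Section sections_oscillation.
Context d1 d2 (T : measurableType d1) (X : measurableType d2) (R : realType)
  (m : {measure set T -> \bar R}) (nu : {finite_measure set X -> \bar R}).

Let sec (S : set (T * X)) (t : T) : set X := [set x | S (t, x)].

Let secE S t : sec S t = xsection S t.
Proof. by apply/seteqP; split=> x; rewrite /sec /xsection/= inE. Qed.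

Let measurable_sec S t : measurable S -> measurable (sec S t).
Proof. by move=> mS; rewrite secE; exact: measurable_xsection. Qed.

Let measurable_fun_sec S : measurable S -> measurable_fun setT (fun t => nu (sec S t)).
Proof.
move=> mS; under eq_fun do rewrite secE.
exact: measurable_fun_xsection.
Qed.

(** A measurable substitute for continuity of the map from t to its section: up to [e] in
    [nu]-measure, the sections agree with one set [B] for all t in a non-null set. Requiring this
    inside every non-null [E0] allows successive shrinking when sets [S] are combined. *)
Definition small_oscillation (S : set (T * X)) := forall (e : R) (E0 : set T),
  0 < e -> measurable E0 -> (0 < m E0)%E ->
  exists E B, [/\ measurable E, E `<=` E0, (0 < m E)%E, measurable B &
    forall t, E t -> (nu ([set x | S (t, x)] `\` B) < e%:E)%E /\
                     (nu (B `\` [set x | S (t, x)]) < e%:E)%E].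

Let nuS (A B : set X) (e : R) : measurable A -> measurable B -> A `<=` B ->
  (nu B < e%:E)%E -> (nu A < e%:E)%E.
Proof. by move=> mA mB AB; apply: le_lt_trans; apply: le_measure; rewrite ?inE. Qed.

Let small_oscillation_rect A B : measurable A -> measurable B -> small_oscillation (A `*` B).
Proof.
move=> mA mB e E0 e0 mE0 E0pos.
(* The section is [B] over [A] and empty elsewhere; one of the two parts of [E0] is not null. *)
have [AE|nAE] := ltP 0%E (m (E0 `&` A)).
  exists (E0 `&` A), B; split => //; first exact: measurableI.
  move=> t [_ At]; rewrite (_ : [set x | _] = B); last first.
    by apply/seteqP; split => x //=; case.
  by rewrite setDv measure0.
exists (E0 `&` ~` A), set0; split => //; first by apply: measurableI => //; exact: measurableC.
  rewrite lt0e measure_ge0 andbT; apply/eqP => Ez.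
  move: E0pos; rewrite (measureDI m mE0 mA) setDE [X in (0 < X + _)%E]Ez add0e.
  by rewrite ltNge nAE.
move=> t [_ At]; rewrite (_ : [set x | _] = set0); last first.
  by apply/seteqP; split => x //= -[].
by rewrite setDv measure0.
Qed.

Let small_oscillation0 : small_oscillation set0.
Proof.
by have := @small_oscillation_rect setT set0 measurableT measurable0; rewrite setX0.
Qed.

Let small_oscillationC S : measurable S -> small_oscillation S -> small_oscillation (~` S).
Proof.
move=> mS oS e E0 e0 mE0 E0pos; have [E [B [mE EE0 Epos mB EB]]] := oS e E0 e0 mE0 E0pos.
exists E, (~` B); split => //; first exact: measurableC.
move=> t /EB[h1 h2] /=.
rewrite (_ : _ `\` ~` B = B `\` [set x | S (t, x)]); last first.
  by apply/seteqP; split => x /= [a b]; split => //; exact: contrapT.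
rewrite (_ : ~` B `\` _ = [set x | S (t, x)] `\` B)//.
by apply/seteqP; split => x /= [a b]; split => //; exact: contrapT.
Qed.

Let small_oscillationU S S' : measurable S -> measurable S' ->
  small_oscillation S -> small_oscillation S' -> small_oscillation (S `|` S').
Proof.
move=> mS mS' oS oS' e E0 e0 mE0 E0pos; have e20 : 0 < e / 2 by rewrite divr_gt0.
have [E1 [B [mE1 E1E0 E1pos mB E1B]]] := oS _ _ e20 mE0 E0pos.
have [E [B' [mE EE1 Epos mB' EB']]] := oS' _ _ e20 mE1 E1pos.
exists E, (B `|` B'); split => //; first exact: subset_trans E1E0.
  exact: measurableU.
move=> t Et; have [h1 h2] := E1B _ (EE1 _ Et); have [h3 h4] := EB' _ Et.
have mSt := @measurable_sec S t mS; have mS't := @measurable_sec S' t mS'.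
have mU : measurable [set x | (S `|` S') (t, x)].
  exact: (@measurable_sec (S `|` S') t (measurableU _ _ mS mS')).
split.
- apply: measure_subU_lt h1 h3; try exact: measurableD.
  + by apply: measurableD => //; exact: measurableU.
  + by move=> x [[Sx|Sx] nB]; [left|right]; split => // Bx; apply: nB; [left|right].
- apply: measure_subU_lt h2 h4; try exact: measurableD.
  + by apply: measurableD => //; exact: measurableU.
  + by move=> x [[Bx|Bx] nS]; [left|right]; split => // Sx; apply: nS; [left|right].
Qed.

(** As [nu] is finite, at each t the section of the part of the union missed by the first n sets
    tends to 0 in measure. The sets [F n] of those t where it is below e / 2 therefore cover [E0];
    one of them is not null, and there the finite union [U n] is treated with the other half of
    [e]. *)
Let small_oscillation_bigcup (S : nat -> set (T * X)) : (forall n, measurable (S n)) ->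
  (forall n, small_oscillation (S n)) -> small_oscillation (\bigcup_n S n).
Proof.
move=> mS oS e E0 e0 mE0 E0pos; have e20 : 0 < e / 2 by rewrite divr_gt0.
pose U n := \big[setU/set0]_(i < n) S i.
have mU n : measurable (U n) by exact: bigsetU_measurable.
have oU n : small_oscillation (U n).
  rewrite /U; elim: n => [|n ih].
    by rewrite big_ord0; exact: small_oscillation0.
  by rewrite big_ord_recr/=; apply: small_oscillationU => //; exact: mU.
have mV : measurable (\bigcup_n S n) by exact: bigcupT_measurable.
have US n : U n `<=` \bigcup_n S n.
  by move=> p; rewrite /U -bigcup_mkord => -[i _ Sip]; exists i.
pose F n := E0 `&` [set t | nu (sec ((\bigcup_n S n) `\` U n) t) < (e / 2)%:E]%E.
have mF n : measurable (F n).
  apply: emeasurable_fun_lt => //; apply: measurable_funTS; apply: measurable_fun_sec.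
  exact: measurableD.
have E0F : E0 `<=` \bigcup_n F n.
  move=> t E0t.
  have /fine_cvgP[_] : nu (sec ((\bigcup_n S n) `\` U n) t) @[n --> \oo] --> 0%E.
    rewrite -(measure0 nu).
    have -> : set0 = \bigcap_n sec ((\bigcup_n S n) `\` U n) t.
      apply/esym/seteqP; split => // x capx.
      have [[i _ Six] _] := capx 0%N Logic.I.
      have [_] := capx i.+1 Logic.I; apply; rewrite /U big_ord_recr/=; by right.
    apply: nonincreasing_cvg_mu.
    - by rewrite -ge0_fin_numE// fin_num_measure//; apply: measurable_sec; exact: measurableD.
    - by move=> n; apply: measurable_sec; exact: measurableD.
    - apply: bigcapT_measurable => n; apply: measurable_sec; exact: measurableD.
    - move=> n k nk; apply/subsetPset => x [Sx nU]; split => // Ux; apply: nU.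
      move: Ux; rewrite /U -!bigcup_mkord => -[i /= ik Si]; exists i => //=.
      exact: leq_trans nk.
  move=> /cvgrPdist_lt/(_ _ e20)[n _ /(_ n (leqnn n))].
  rewrite sub0r normrN ger0_norm ?fine_ge0// => ne.
  exists n => //; split => //=; rewrite -lte_fin fineK// in ne.
  by rewrite fin_num_measure//; apply: measurable_sec; exact: measurableD.
have [n Fpos] := measure_bigcup_pos mF mE0 E0pos E0F.
have [E [B [mE EF Epos mB EB]]] := oU n _ _ e20 (mF n) Fpos.
exists E, B; split => //; first by move=> t /EF[].
move=> t Et; have [h1 h2] := EB _ Et; have [_ h3] := EF _ Et.
split.
- apply: measure_subU_lt h3 h1.
  + by apply: measurableD => //; exact: (@measurable_sec _ t mV).
  + by apply: measurable_sec; exact: measurableD.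
  + by apply: measurableD => //; exact: (@measurable_sec _ t (mU n)).
  + move=> x [Sx nB]; have [Ux|nUx] := pselect (U n (t, x)); first by right.
    by left.
- apply: nuS _ _ _ (lt_trans h2 _); last by rewrite lte_fin ltr_pdivrMr// ltr_pMr// ltr1n.
  + by apply: measurableD => //; exact: (@measurable_sec _ t mV).
  + by apply: measurableD => //; exact: (@measurable_sec _ t (mU n)).
  + by move=> x [Bx nS]; split => // /US.
Qed.

(* The class of such sets is a sigma-algebra containing the rectangles. *)
Lemma measurable_small_oscillation S : measurable S -> small_oscillation S.
Proof.
move=> mS.
pose C := [set S : set (T * X) | measurable S /\ small_oscillation S].
suff : C S by case.
rewrite measurable_prod_measurableType in mS.
apply: (smallest_sub (X := C) _ _ mS); last first.
  move=> _ [A mA [B mB <-]]; split; last exact: small_oscillation_rect.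
  exact: measurableX.
split.
- by split => //; exact: small_oscillation0.
- move=> A [mA oA]; rewrite setTD; split; first exact: measurableC.
  exact: small_oscillationC.
- move=> F mF; split; first by apply: bigcupT_measurable => n; case: (mF n).
  by apply: small_oscillation_bigcup => n; case: (mF n).
Qed.

End sections_oscillation.

(** * The L^1 seminorm *)

Section L1_norm.
Context d (X : measurableType d) (R : realType) (mu : {measure set X -> \bar R}).

(** Extended real values let the estimates below be stated without integrability hypotheses. *)
Definition L1norm (u : X -> R) : \bar R := (\int[mu]_x (`|u x|)%:E)%E.

Lemma L1norm_ge0 u : (0 <= L1norm u)%E.
Proof. by apply: integral_ge0 => x _; rewrite lee_fin. Qed.

Lemma measurable_abs_EFin (u : X -> R) : measurable_fun setT u ->
  measurable_fun setT (fun x => (`|u x|)%:E).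
Proof. by move=> mu_; apply/measurable_EFinP; exact: measurableT_comp. Qed.

Lemma L1norm_distC (u v : X -> R) :
  L1norm (fun x => (u x - v x)%R) = L1norm (fun x => (v x - u x)%R).
Proof. by apply: eq_integral => x _; rewrite distrC. Qed.

Lemma L1norm_leD (u v w : X -> R) : measurable_fun setT u ->
  measurable_fun setT v -> measurable_fun setT w ->
  (forall x, `|u x| <= `|v x| + `|w x|) -> (L1norm u <= L1norm v + L1norm w)%E.
Proof.
move=> mu1 mv mw uvw; rewrite /L1norm -ge0_integralD//; try exact: measurable_abs_EFin.
apply: ge0_le_integral => //.
- exact: measurable_abs_EFin.
- by apply: emeasurable_funD; exact: measurable_abs_EFin.
- by move=> x _; rewrite -EFinD lee_fin.
Qed.

Lemma L1normZ (c : R) (u : X -> R) : measurable_fun setT u ->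
  L1norm (fun x => c * u x) = (`|c|%:E * L1norm u)%E.
Proof.
move=> mu1; rewrite /L1norm -ge0_integralZl//; last exact: measurable_abs_EFin.
by apply: eq_integral => x _; rewrite normrM EFinM.
Qed.

Lemma L1norm_sum (I : Type) (s : seq I) (u : I -> X -> R) :
  (forall i, measurable_fun setT (u i)) ->
  (L1norm (fun x => (\sum_(i <- s) u i x)%R) <= \sum_(i <- s) L1norm (u i))%E.
Proof.
move=> mu1; rewrite /L1norm -ge0_integral_sum//; last by move=> i; exact: measurable_abs_EFin.
apply: ge0_le_integral => //.
- by apply: measurable_abs_EFin; exact: measurable_sum.
- by apply: emeasurable_sum => i; exact: measurable_abs_EFin.
- by move=> x _; rewrite sumEFin lee_fin; exact: ler_norm_sum.
Qed.

Lemma L1norm_lty (u : X -> R) : measurable_fun setT u ->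
  (L1norm u < +oo)%E <-> mu.-integrable setT (EFin \o u).
Proof.
move=> mu1; split => [u1|/integrableP[]//].
by apply/integrableP; split => //; exact/measurable_EFinP.
Qed.

End L1_norm.

Section measurable_action.
Context (R : realType) (G : topologicalGroupType) d (X : measurableType d)
  (mu : {measure set X -> \bar R}) (act : G -> X -> X).
Hypotheses (act_borel : borel_action act) (act_mp : measure_preserving_action mu act).

Lemma act_measurable2 : measurable_fun setT (fun p : borel G * X => act p.1 p.2).
Proof. by case: act_borel. Qed.

Lemma act_measurable (s : G) : measurable_fun setT (act s).
Proof.
exact: (measurableT_comp act_measurable2 (@pair1_measurable _ _ (borel G) X s)).
Qed.

Lemma act1 x : act 1%g x = x. Proof. by case: act_borel. Qed.

Lemma actM s t x : act (s * t)%g x = act s (act t x). Proof. by case: act_borel. Qed.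

Lemma L1norm_act (s : G) (u : X -> R) : measurable_fun setT u ->
  L1norm mu (fun x => u (act s x)) = L1norm mu u.
Proof.
move=> mu1.
have := @ge0_integral_preserving _ _ _ mu (act s) (act_measurable s) (act_mp s) setT
  (fun x => (`|u x|)%:E) measurableT.
by rewrite preimage_setT; apply => //; exact: measurable_abs_EFin.
Qed.

End measurable_action.

(** * Continuity at the identity of the action on L^1 *)

Section L1_continuity.
Context (R : realType) (G : topologicalGroupType) (rho : {measure set (borel G) -> \bar R})
  d (X : measurableType d) (mu : {sigma_finite_measure set X -> \bar R}) (act : G -> X -> X).
Hypotheses (hG : hausdorff_space G) (sG : sigma_compact G) (rho_haar : haar_measure rho).
Hypotheses (act_borel : borel_action act) (act_mp : measure_preserving_action mu act).

Definition L1_continuous (f : X -> R) := forall e : R, 0 < e ->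
  \forall v \near (1%g : G), (L1norm mu (fun x => f (act v x) - f x)%R < e%:E)%E.

Let mact s := act_measurable act_borel s.

Let mactf s (f : X -> R) : measurable_fun setT f -> measurable_fun setT (fun x => f (act s x)).
Proof. by move=> mf; exact: (measurableT_comp mf (mact s)). Qed.

(** There is a non-null set [E] of t whose preimages of [B] are pairwise close: they have little
    mass outside some [Y k] of finite measure, and inside it they are near a common [B']. By
    [steinhaus], v near 1 satisfies v a = b with a, b in [E]. Pulling back by [act a], which
    preserves [mu], turns the difference between v^-1 B and B into that between b^-1 B and a^-1
    B. *)
Lemma near_measure_setD_act (B : set X) (e : R) : measurable B -> (mu B < +oo)%E -> 0 < e ->
  \forall v \near (1%g : G), (mu (act v @^-1` B `\` B) < e%:E)%E /\
                             (mu (B `\` act v @^-1` B) < e%:E)%E.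
Proof.
move=> mB Bfin e0.
(* Two preimages are compared through [B'] inside [Y k], at a cost of e / 4 each; the remaining e /
   2 covers the part outside [Y k]. *)
pose e4 := e / 2 / 2; have e40 : 0 < e4 by rewrite !divr_gt0.
have mP t : measurable (act t @^-1` B) by rewrite -[X in measurable X]setTI; exact: mact.
have /sigma_finiteP[Y [YT Ynd Yfin]] := sigma_finiteT mu.
have mY k : measurable (Y k) by case: (Yfin k).
pose S : set (borel G * X) := [set p | B (act p.1 p.2)].
have mS : measurable S.
  by rewrite -[S]setTI; exact: (act_measurable2 act_borel).
pose F k : set (borel G) := [set t | (mu (act t @^-1` B `\` Y k) < e4%:E)%E].
have mF k : measurable (F k).
  rewrite -[F k]setTI; apply: emeasurable_fun_lt => //.
  have mSY : measurable (S `\` (setT `*` Y k)) by apply: measurableD => //; exact: measurableX.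
  rewrite (_ : (fun t => _) = mu \o xsection (S `\` (setT `*` Y k))).
    exact: measurable_fun_xsection.
  apply/funext => t /=; congr (mu _); apply/seteqP; split => x; rewrite /xsection/= inE/=.
    by move=> [? nY]; split => // -[].
  by move=> [? nY]; split => // ?; apply: nY.
have FT : setT `<=` \bigcup_k F k.
  move=> t _.
  have : mu (act t @^-1` B `\` Y k) @[k --> \oo] --> 0%E.
    have -> : 0%E = mu (\bigcap_k (act t @^-1` B `\` Y k)).
      rewrite (_ : \bigcap_k _ = set0) ?measure0//; apply/seteqP; split => // x cap.
      have : (\bigcup_k Y k) x by rewrite -YT.
      by move=> [k _ Ykx]; have [_] := cap k Logic.I; apply.
    apply: nonincreasing_cvg_mu.
    - apply: le_lt_trans Bfin; rewrite -(act_mp t mB).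
      by apply: le_measure; rewrite ?inE//; exact: measurableD.
    - by move=> k; exact: measurableD.
    - by apply: bigcapT_measurable => k; exact: measurableD.
    - move=> n k nk; apply/subsetPset; apply: setDS.
      by apply/subsetPset; exact: Ynd.
  move=> /fine_cvgP[[m _ mfin]] /cvgrPdist_lt/(_ _ e40)[n _ ne].
  exists (maxn m n) => //=; rewrite /F/=.
  have := mfin (maxn m n) (leq_maxl _ _); have := ne (maxn m n) (leq_maxr _ _) => /=.
  rewrite sub0r normrN ger0_norm ?fine_ge0// => h hf.
  by rewrite -(fineK hf) lte_fin.
have [G0 _ _ _ _] := rho_haar.
have [k Fpos] := measure_bigcup_pos mF measurableT G0 FT.
have [_ Ykfin] := Yfin k.
have [E [B' [mE EF Epos mB' EB']]] :=
  @measurable_small_oscillation _ _ (borel G) X R rho (mfrestr (mY k) Ykfin) S mS _ _ e40 (mF k) Fpos.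
have key (t s : G) : E t -> E s -> (mu (act t @^-1` B `\` act s @^-1` B) < e%:E)%E.
  move=> Et Es; have [h1 _] := EB' _ Et; have [_ h2] := EB' _ Es.
  have h3 := EF _ Et.
  have mPk (A C : set X) : measurable A -> measurable C -> measurable ((A `\` C) `&` Y k).
    by move=> mA mC; apply: measurableI => //; exact: measurableD.
  apply: (measure_subU_lt (B := act t @^-1` B `\` Y k)
    (C := ((act t @^-1` B `\` B') `&` Y k) `|` ((B' `\` act s @^-1` B) `&` Y k))).
  - exact: measurableD.
  - exact: measurableD.
  - by apply: measurableU; exact: mPk.
  - move=> x [Bt nBs]; have [Yx|nYx] := pselect (Y k x); last by left.
    by right; have [B'x|nB'x] := pselect (B' x); [right|left].
  - by apply: lt_le_trans h3 _; rewrite lee_fin /e4 ler_pdivrMr// ler_peMr// ?ler1n// divr_ge0// ltW.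
  - apply: (measure_subU_lt (B := (act t @^-1` B `\` B') `&` Y k)
      (C := (B' `\` act s @^-1` B) `&` Y k) _ _ _ _ h1 h2) => //; try exact: mPk.
    by apply: measurableU; exact: mPk.
apply: filterS (steinhaus hG sG rho_haar mE Epos) => v [a [b [Ea Eb vab]]].
have bE : act b @^-1` B = act a @^-1` (act v @^-1` B).
  by apply/seteqP; split => x /=; rewrite -vab (actM act_borel).
split; rewrite -(act_mp a); try exact: measurableD.
  by rewrite !setDE preimage_setI -preimage_setC -bE -setDE; exact: key.
by rewrite !setDE preimage_setI -preimage_setC -bE -setDE; exact: key.
Qed.

Lemma L1_continuous_indic (B : set X) : measurable B -> (mu B < +oo)%E ->
  L1_continuous (\1_B : X -> R).
Proof.
move=> mB Bfin e e0; have e20 : 0 < e / 2 by rewrite divr_gt0.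
apply: filterS (near_measure_setD_act mB Bfin e20) => v [h1 h2].
have mP : measurable (act v @^-1` B) by rewrite -[X in measurable X]setTI; exact: mact.
have E (A : set X) : measurable A -> L1norm mu (\1_A : X -> R) = mu A.
  move=> mA; rewrite /L1norm -[in RHS](setIT A) -integral_indic//.
  by apply: eq_integral => x _; rewrite indicE ger0_norm.
rewrite [e]splitr EFinD; apply: le_lt_trans (lteD h1 h2).
rewrite -(E (_ `\` B)); last exact: measurableD.
rewrite -(E (B `\` _)); last exact: measurableD.
apply: L1norm_leD.
- by apply: measurable_funB; [apply: mactf|]; exact: measurable_indic.
- by apply: measurable_indic; exact: measurableD.
- by apply: measurable_indic; exact: measurableD.
- move=> x; rewrite !indicE !in_setD.
  have -> : (x \in act v @^-1` B) = (act v x \in B).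
    by apply/idP/idP; rewrite !inE.
  by case: (act v x \in B); case: (x \in B);
    rewrite /= ?subrr ?subr0 ?sub0r ?normrN ?normr0 ?normr1 ?add0r ?addr0.
Qed.

Lemma L1_continuousZ (c : R) (f : X -> R) : measurable_fun setT f ->
  L1_continuous f -> L1_continuous (fun x => c * f x).
Proof.
move=> mf cf e e0.
(* The added 1 keeps the denominator positive when c = 0. *)
have e1 : 0 < e / (`|c| + 1) by rewrite divr_gt0// ltr_wpDl.
apply: filterS (cf _ e1) => v h.
rewrite (_ : (fun x => _) = (fun x => c * (f (act v x) - f x))); last first.
  by apply/funext => x; rewrite mulrBr.
rewrite L1normZ; last by apply: measurable_funB => //; exact: mactf.
apply: (@le_lt_trans _ _ ((`|c| + 1)%:E * L1norm mu (fun x => f (act v x) - f x)%R)%E).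
  by apply: lee_wpmul2r; [exact: L1norm_ge0|rewrite lee_fin lerDl].
by rewrite -lte_pdivlMl ?ltr_wpDl// -EFinM mulrC.
Qed.

Lemma L1_continuousD (f g : X -> R) : measurable_fun setT f -> measurable_fun setT g ->
  L1_continuous f -> L1_continuous g -> L1_continuous (fun x => f x + g x).
Proof.
move=> mf mg cf cg e e0; have e20 : 0 < e / 2 by rewrite divr_gt0.
apply: filterS2 (cf _ e20) (cg _ e20) => v h1 h2.
rewrite [e]splitr EFinD; apply: le_lt_trans (lteD h1 h2).
apply: L1norm_leD.
- by apply: measurable_funB; [apply: measurable_funD => //; exact: mactf|exact: measurable_funD].
- by apply: measurable_funB => //; exact: mactf.
- by apply: measurable_funB => //; exact: mactf.
- by move=> x; rewrite opprD addrACA; exact: ler_normD.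
Qed.

Lemma L1_continuous0 : L1_continuous (fun=> 0).
Proof.
move=> e e0; apply: filterE => v; rewrite subrr /L1norm normr0.
by rewrite integral0 lte_fin.
Qed.

Lemma L1_continuous_sum (I : Type) (s : seq I) (f : I -> X -> R) :
  (forall i, measurable_fun setT (f i)) -> (forall i, L1_continuous (f i)) ->
  L1_continuous (fun x => \sum_(i <- s) f i x).
Proof.
move=> mf cf; elim: s => [|i s ih].
  by under [X in L1_continuous X]eq_fun do rewrite big_nil; exact: L1_continuous0.
under [X in L1_continuous X]eq_fun do rewrite big_cons.
by apply: L1_continuousD => //; exact: measurable_sum.
Qed.

Lemma L1_continuous_sfun (g : {sfun X >-> R}) : mu.-integrable setT (EFin \o g) ->
  L1_continuous g.
Proof.
move=> ig; pose s := fset_set (g @` setT).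
have mg : measurable_fun setT g by exact: measurable_funP.
have mB y : measurable (g @^-1` [set y]) by rewrite -[X in measurable X]setTI; exact: mg.
rewrite (_ : (g : X -> R) = fun x => \sum_(i < #|`s|) (s`_i * \1_(g @^-1` [set s`_i]) x)); last first.
  by apply/funext => x; rewrite fimfunEord.
apply: L1_continuous_sum => i; first by apply: measurable_funM => //; exact: measurable_indic.
(* The level set of 0 may have infinite measure, but its term vanishes. The other level sets have
   finite measure because |y| mu(g = y) is at most the integral of |g|. *)
set y := s`_i; have [->|y0] := eqVneq y 0.
  by under [X in L1_continuous X]eq_fun do rewrite mul0r; exact: L1_continuous0.
apply: L1_continuousZ; first exact: measurable_indic.
apply: L1_continuous_indic => //.
have /integrableP[_] := ig; rewrite ltNge => /negP ifin; rewrite ltNge; apply/negP.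
rewrite leye_eq => /eqP Binf; apply: ifin.
apply: (@le_trans _ _ (`|y|%:E * mu (g @^-1` [set y]))%E).
  by rewrite Binf gt0_muley// lte_fin normr_gt0.
rewrite -(setIT (g @^-1` [set y])) -integral_indic// -ge0_integralZl//; last first.
  by apply/measurable_EFinP; exact: measurable_indic.
apply: ge0_le_integral => //.
- by apply: measurable_funeM; apply/measurable_EFinP; exact: measurable_indic.
- by apply: measurableT_comp => //; exact/measurable_EFinP.
- move=> x _ /=; rewrite lee_fin indicE; have [|] := boolP (x \in _).
    by rewrite inE/= => ->; rewrite mulr1.
  by rewrite mulr0.
Qed.

Theorem integrable_L1_continuous (f : X -> R) : measurable_fun setT f ->
  mu.-integrable setT (EFin \o f) -> L1_continuous f.
Proof.
move=> mf /(approximation_sfun_integrable measurableT)[g [ig _ gf]] e e0.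
have e30 : 0 < e / 3 by rewrite divr_gt0.
have [n fgn] : exists n, (L1norm mu (fun x => f x - g n x)%R < (e / 3)%:E)%E.
  move: gf => /fine_cvgP[[k _ kfin]] /cvgrPdist_lt/(_ _ e30)[n _ ne].
  exists (maxn k n).
  have := kfin _ (leq_maxl k n); have := ne _ (leq_maxr k n) => /=.
  rewrite sub0r normrN ger0_norm ?fine_ge0//; last exact: integral_ge0.
  by move=> h hf; rewrite -lte_fin fineK in h.
have mg : measurable_fun setT (g n) by exact: measurable_funP.
apply: filterS (L1_continuous_sfun (ig n) e30) => v h.
have -> : e%:E = ((e / 3)%:E + ((e / 3)%:E + (e / 3)%:E))%E.
  by rewrite -!EFinD; congr EFin; field.
have mfg : measurable_fun setT (fun x => f x - g n x) by exact: measurable_funB.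
apply: (@le_lt_trans _ _ (L1norm mu (fun x => f (act v x) - g n (act v x))%R +
   (L1norm mu (fun x => g n (act v x) - g n x)%R + L1norm mu (fun x => f x - g n x)%R))%E); last first.
  rewrite lteD//; last by rewrite lteD.
  by rewrite (L1norm_act act_borel act_mp v mfg).
apply: (@le_trans _ _ (L1norm mu (fun x => f (act v x) - g n (act v x))%R +
   L1norm mu (fun x => g n (act v x) - f x)%R)%E).
  apply: L1norm_leD; try by apply: measurable_funB => //; exact: mactf.
  by move=> x; apply: le_trans (ler_normD _ _); rewrite addrA subrK.
rewrite leeD2l//; apply: L1norm_leD; try by apply: measurable_funB => //; exact: mactf.
move=> x; rewrite -[X in _ <= _ + X]normrN opprB.
by apply: le_trans (ler_normD _ _); rewrite addrA subrK.
Qed.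

End L1_continuity.

(** * Averages over lattice points and their convergence in L^1 *)

Section tonelli_restricted.
Context d1 d2 (T : measurableType d1) (X : measurableType d2) (R : realType)
  (m : {measure set T -> \bar R}) (mu : {sigma_finite_measure set X -> \bar R}).
Context (A : set T) (phi : T * X -> \bar R).
Hypotheses (mA : measurable A) (Afin : (m A < +oo)%E)
  (mphi : measurable_fun setT phi) (phi0 : forall p, (0 <= phi p)%E).

(** Here [m] is a bare measure, whereas [fubini_tonelli] wants sigma-finite ones. Its restriction to
    [A] is finite, and [psi] extends [phi] by zero outside [A], so that integrals over the whole
    space can be used. *)
Let mr : {finite_measure set T -> \bar R} := mfrestr mA Afin.
Let psi : T * X -> \bar R := phi \_ (A `*` setT).

Let mpsi : measurable_fun setT psi.
Proof.
apply/(measurable_restrictT _ (measurableX mA measurableT)).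
exact: measurable_funTS.
Qed.

Let psi0 p : (0 <= psi p)%E. Proof. by rewrite /psi/patch; case: ifP. Qed.

Let psiE x t : psi (t, x) = ((fun t => phi (t, x)) \_ A) t.
Proof.
rewrite /psi /patch.
by have -> : ((t, x) \in A `*` setT) = (t \in A) by apply/idP/idP; rewrite !inE => // -[].
Qed.

Let integral_psi x : (\int[m]_(t in A) phi (t, x) = \int[mr]_t psi (t, x))%E.
Proof.
under [RHS]eq_integral do rewrite psiE.
rewrite -integral_mkcond; apply: eq_measure_integral => B mB BA.
by rewrite /mr /= /mfrestr /mrestr setIidl.
Qed.

Lemma measurable_integral_restr :
  measurable_fun setT (fun x => \int[m]_(t in A) phi (t, x))%E.
Proof.
rewrite (_ : (fun x => _) = fubini_G mr psi); last by apply/funext => x; exact: integral_psi.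
exact: measurable_fun_fubini_tonelli_G.
Qed.

Lemma tonelli_restr : (\int[m]_(t in A) \int[mu]_x phi (t, x) =
  \int[mu]_x \int[m]_(t in A) phi (t, x))%E.
Proof.
under [RHS]eq_integral do rewrite integral_psi.
rewrite -(@fubini_tonelli _ _ _ _ _ mr mu psi mpsi psi0).
transitivity (\int[mr]_(t in A) \int[mu]_x phi (t, x))%E.
  by apply: eq_measure_integral => B mB BA; rewrite /mr /= /mfrestr /mrestr setIidl.
rewrite integral_mkcond; apply: eq_integral => t _; rewrite /patch.
case: ifPn => tA; first by apply: eq_integral => x _; rewrite psiE /patch tA.
by rewrite integral0_eq// => x _; rewrite psiE /patch (negbTE tA).
Qed.

Lemma measurable_integral_section : measurable_fun setT (fun t => \int[mu]_x phi (t, x))%E.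
Proof. exact: (measurable_fun_fubini_tonelli_F (m2 := mu)). Qed.

End tonelli_restricted.

Section lattice_averages.
Context (R : realType) (G : topologicalGroupType) (rho : {measure set (borel G) -> \bar R})
  d (X : measurableType d) (mu : {sigma_finite_measure set X -> \bar R}) (act : G -> X -> X).
Hypotheses (rho_haar : haar_measure rho).
Hypotheses (act_borel : borel_action act) (act_mp : measure_preserving_action mu act).
Context (H : set G) (D : set (borel G)).
Hypotheses (gH : is_subgroup H) (cH : countable H) (fD : fundamental_domain H D)
  (rhoD : rho D = 1%E).
Context (f : X -> R).
Hypotheses (mf : measurable_fun setT f) (fint : mu.-integrable setT (EFin \o f))
  (fH : forall g x, H g -> f (act g x) = f x).

Definition lattice_sum (L : set G) (x : X) : R :=
  \sum_(t <- fset_set (L `&` D)) f (act t x).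

Definition lattice_avg (L : set G) (x : X) : R :=
  (#|` fset_set (L `&` D)|%:R)^-1 * lattice_sum L x.

(** This real-valued integral is the [fine] part of the extended one, so it has the intended meaning
    only where the orbit function is integrable on [D], which holds almost everywhere by
    [ae_integrable_orbit]. *)
Definition orbit_mean (x : X) : R := \int[rho]_(t in D) f (act t x).

Let mD : measurable D. Proof. by case: fD. Qed.
Let D_finite : (rho D < +oo)%E. Proof. by rewrite rhoD ltry. Qed.
Let mact s := act_measurable act_borel s.
Let mfact s : measurable_fun setT (fun x => f (act s x)).
Proof. exact: (measurableT_comp mf (mact s)). Qed.

Let mf2 : measurable_fun setT (fun p : borel G * X => f (act p.1 p.2)).
Proof. exact: (measurableT_comp mf (act_measurable2 act_borel)). Qed.

Let mfx x : measurable_fun setT (fun t : borel G => f (act t x)).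
Proof. exact: (measurableT_comp mf2 (@pair2_measurable _ _ (borel G) X x)). Qed.

Let fxH x g t : H g -> f (act (g * t)%g x) = f (act t x).
Proof. by move=> Hg; rewrite (actM act_borel) fH. Qed.

Lemma measurable_lattice_sum L : measurable_fun setT (lattice_sum L).
Proof. exact: measurable_sum. Qed.

Lemma measurable_lattice_avg L : measurable_fun setT (lattice_avg L).
Proof. by apply: measurable_funM => //; exact: measurable_lattice_sum. Qed.

Let fpos (p : borel G * X) : \bar R := (Num.max (f (act p.1 p.2)) 0)%:E.
Let fneg (p : borel G * X) : \bar R := (Num.max (- f (act p.1 p.2)) 0)%:E.

(** Tonelli gives measurability of the integrals of the positive and negative parts. As [fine] is
    measurable, no exceptional points x have to be removed. *)
Lemma measurable_orbit_mean : measurable_fun setT orbit_mean.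
Proof.
have e x : orbit_mean x = fine (\int[rho]_(t in D) fpos (t, x) - \int[rho]_(t in D) fneg (t, x))%E.
  rewrite /orbit_mean /Rintegral integralE; congr (fine (_ - _))%E.
  - by apply: eq_integral => t _; rewrite funeposE /fpos/= EFin_max.
  - by apply: eq_integral => t _; rewrite funenegE /fneg/= EFin_max.
rewrite (funext e); apply: (measurableT_comp (@fine_measurable R setT measurableT)).
apply: emeasurable_funB; apply: (@measurable_integral_restr _ _ _ _ _ _ _ _ mD D_finite).
- by apply/measurable_EFinP; apply: measurable_maxr.
- by move=> p; rewrite lee_fin le_max lexx orbT.
- by apply/measurable_EFinP; apply: measurable_maxr => //; exact: measurableT_comp.
- by move=> p; rewrite lee_fin le_max lexx orbT.
Qed.

(** By Tonelli and invariance of [mu], the integral over x and over t in [D] of |f(t x)| is [rho D]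
    times the norm of [f], hence finite. *)
Lemma ae_integrable_orbit :
  \forall x \ae mu, rho.-integrable D (fun t => (f (act t x))%:E).
Proof.
pose phi (p : borel G * X) : \bar R := (`|f (act p.1 p.2)|)%:E.
have mphi : measurable_fun setT phi by apply/measurable_EFinP; exact: measurableT_comp.
have phi0 p : (0 <= phi p)%E by rewrite lee_fin.
have mI := measurable_integral_restr mD D_finite mphi phi0.
have I0 x : (0 <= \int[rho]_(t in D) phi (t, x))%E by exact: integral_ge0.
have : mu.-integrable setT (fun x => \int[rho]_(t in D) phi (t, x))%E.
  apply/integrableP; split => //.
  under eq_integral do rewrite gee0_abs//.
  rewrite -(tonelli_restr mu mD D_finite mphi phi0).
  rewrite (eq_integral (cst (L1norm mu f))); last first.
    by move=> t _; exact: (L1norm_act act_borel act_mp t mf).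
  by rewrite (integral_cst _ mD) rhoD mule1; exact/(L1norm_lty mu mf).
move=> /(integrable_ae measurableT); apply: filterS => x /(_ Logic.I) xfin.
apply/integrableP; split; first by apply: measurable_funTS; exact/measurable_EFinP.
by move: xfin; rewrite ge0_fin_numE.
Qed.

Section one_lattice.
Context (L : set G) (F : set (borel G)).
Hypotheses (gL : is_subgroup L) (cL : countable L) (HL : H `<=` L)
  (fF : fundamental_domain L F).

Let S := fset_set (L `&` D).
Let mF : measurable F. Proof. by case: fF. Qed.

Lemma lattice_sum_act l x : L l -> lattice_sum L (act l x) = lattice_sum L x.
Proof.
move=> Ll; rewrite /lattice_sum.
under eq_bigr do rewrite -(actM act_borel).
apply: (sum_lattice_points_mulgr rho_haar gH gL HL cH cL fD fF D_finite
  (c := fun t => f (act t x)) Ll).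
by move=> g t; exact: fxH.
Qed.

Lemma lattice_avg_act l x : L l -> lattice_avg L (act l x) = lattice_avg L x.
Proof. by move=> Ll; rewrite /lattice_avg lattice_sum_act. Qed.

Let card_rhoF : ((size S)%:R%:E * rho F = 1)%E.
Proof. by rewrite -rhoD; exact: (lattice_points_measure rho_haar gH gL HL cH cL fD fF). Qed.

Lemma lattice_points_gt0 : (0 < size S)%N.
Proof.
rewrite lt0n; apply/negP => /eqP S0; move: card_rhoF.
by rewrite S0 mul0e => /eqP; rewrite eq_sym onee_eq0.
Qed.

Lemma measure_fundamental_domain : rho F = ((size S)%:R^-1)%:E.
Proof.
have k0 : 0 < (size S)%:R :> R by rewrite ltr0n lattice_points_gt0.
have F0 : (0 <= rho F)%E by exact: measure_ge0.
move: card_rhoF F0; case: (rho F) => [r|kF|//].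
  by rewrite -EFinM => -[kr] _; congr EFin; apply: (mulfI (lt0r_neq0 k0)); rewrite kr mulfV ?lt0r_neq0.
by move: kF; rewrite gt0_muley ?lte_fin.
Qed.

Let F_finite : (rho F < +oo)%E. Proof. by rewrite measure_fundamental_domain ltry. Qed.

Let mB : measurable_fun setT (lattice_sum L) := @measurable_lattice_sum L.

(** Sums rather than averages: integrating over [F], of measure 1 / #|S|, supplies the
    normalization. *)
Let u (p : borel G * X) : R := lattice_sum L (act p.1 p.2) - lattice_sum L p.2.

Let mu2 : measurable_fun setT u.
Proof.
apply: measurable_funB; first exact: (measurableT_comp mB (act_measurable2 act_borel)).
exact: (measurableT_comp mB measurable_snd).
Qed.

Let le_orbit_mean_avg x : rho.-integrable D (fun t => (f (act t x))%:E) ->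
  ((`|orbit_mean x - lattice_avg L x|)%:E <= \int[rho]_(t in F) (`|u (t, x)|)%:E)%E.
Proof.
move=> ix.
have [iF DF] := integral_unfold rho_haar gH gL HL cH cL fD fF D_finite (mfx x) ix (fxH x).
have sumE t : \sum_(s <- S) f (act (s * t)%g x) = lattice_sum L (act t x).
  by apply: eq_bigr => s _; rewrite (actM act_borel).
have iFB : rho.-integrable F (fun t => (lattice_sum L (act t x))%:E).
  by apply: eq_integrable iF => // t _; rewrite sumE.
have iFc : rho.-integrable F (fun=> (lattice_sum L x)%:E).
  apply/integrableP; split => //; rewrite integral_cst//.
  by rewrite measure_fundamental_domain -EFinM ltry.
rewrite -[leLHS]abse_EFin.
have -> : (orbit_mean x - lattice_avg L x)%:E = (\int[rho]_(t in F) (u (t, x))%:E)%E.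
  rewrite EFinB /orbit_mean /Rintegral fineK; last exact: integrable_fin_num.
  rewrite DF; under eq_integral do rewrite sumE.
  rewrite /u; under [RHS]eq_integral do rewrite EFinB.
  rewrite integralB//; congr (_ - _)%E.
  rewrite [RHS](integral_cst rho mF (lattice_sum L x)%:E).
  by rewrite measure_fundamental_domain -EFinM /lattice_avg mulrC.
apply: (le_trans (le_abse_integral rho mF _)).
  apply/measurable_EFinP; apply: measurable_funTS.
  exact: (measurableT_comp mu2 (@pair2_measurable _ _ (borel G) X x)).
by [].
Qed.

(** The unfolding is used in both directions. It turns [orbit_mean] into an integral over [F], which
    is compared with the constant [lattice_sum L x]; then a bound on [F] that is itself a sum over
    [S] of an [H]-invariant weight [w] folds back into an integral over [D], whose size does not
    depend on the lattice [L]. *)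
Lemma L1norm_orbit_mean_avg (w : borel G -> \bar R) :
  measurable_fun setT w -> (forall t, 0 <= w t)%E ->
  (forall g t, H g -> w (g * t)%g = w t) ->
  (forall t, F t -> (L1norm mu (fun x => (lattice_sum L (act t x) - lattice_sum L x)%R) <=
                     \sum_(s <- S) w (s * t)%g)%E) ->
  (L1norm mu (fun x => (orbit_mean x - lattice_avg L x)%R) <= \int[rho]_(t in D) w t)%E.
Proof.
move=> mw w0 wH uw.
pose phi (p : borel G * X) := (`|u p|)%:E.
have mphi : measurable_fun setT phi by exact: measurable_abs_EFin.
have phi0 p : (0 <= phi p)%E by rewrite lee_fin.
apply: (@le_trans _ _ (\int[mu]_x \int[rho]_(t in F) phi (t, x))%E).
  apply: ae_ge0_le_integral => //.
  - by apply: measurable_abs_EFin; apply: measurable_funB;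
      [exact: measurable_orbit_mean|exact: measurable_lattice_avg].
  - by move=> x _; exact: integral_ge0.
  - exact: (measurable_integral_restr mF F_finite mphi phi0).
  - by apply: filterS ae_integrable_orbit => x ix _; exact: le_orbit_mean_avg.
rewrite -(tonelli_restr mu mF F_finite mphi phi0).
rewrite (ge0_integral_unfold rho_haar gH gL HL cH cL fD fF D_finite mw w0 wH).
apply: ge0_le_integral => //.
- by move=> t _; exact: integral_ge0.
- by apply: measurable_funTS; exact: measurable_integral_section.
- apply: measurable_funTS; apply: emeasurable_sum => s.
  by apply: (measurableT_comp mw); exact: measurable_mulgl.
Qed.

End one_lattice.

End lattice_averages.

(** * Convergence of the averages in L^1 *)

Section L1_convergence.
Context (R : realType) (G : topologicalGroupType) (rho : {measure set (borel G) -> \bar R})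
  d (X : measurableType d) (mu : {sigma_finite_measure set X -> \bar R}) (act : G -> X -> X).
Hypotheses (hG : hausdorff_space G) (sG : sigma_compact G) (rho_haar : haar_measure rho).
Hypotheses (act_borel : borel_action act) (act_mp : measure_preserving_action mu act).
Context (G_ : nat -> set G) (D : set (borel G)).
Hypotheses (gG : forall n, is_subgroup (G_ n)) (cG : forall n, countable (G_ n))
  (Gincr : forall m n, (m <= n)%N -> G_ m `<=` G_ n) (Gdense : dense (\bigcup_n G_ n))
  (fG : forall n, exists F : set (borel G), fundamental_domain (G_ n) F).
Let H := G_ 0%N.
Hypotheses (fD : fundamental_domain H D) (rhoD : rho D = 1%E).

Let mD : measurable D. Proof. by case: fD. Qed.
Let D_finite : (rho D < +oo)%E. Proof. by rewrite rhoD ltry. Qed.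
Let mact s := act_measurable act_borel s.

(** For a subgroup [L] this is the product set L A. *)
Let saturation (L A : set G) : set (borel G) := [set t | exists2 g, L g & A (g * t)%g].

Let measurable_saturation L (A : set (borel G)) : countable L -> L 1%g -> measurable A ->
  measurable (saturation L A).
Proof.
move=> cL L1 mA; have [e eL] := countable_enum cL L1.
rewrite (_ : saturation L A = \bigcup_i ((fun t : borel G => (e i * t)%g : borel G) @^-1` A)).
  apply: bigcupT_measurable => i; rewrite -[X in measurable X]setTI.
  exact: measurable_mulgl.
apply/seteqP; split => [t [g + Ag]|t [i _ Ai]].
  by rewrite -eL => -[i _ ei]; exists i => //=; rewrite ei.
by exists (e i) => //; rewrite -eL; exists i.
Qed.

Let saturationM L A g t : is_subgroup L -> L g -> saturation L A (g * t)%g <-> saturation L A t.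
Proof.
move=> [L1 LM LV] Lg; split => -[h Lh Ah].
  by exists (h * g)%g; [exact: LM|rewrite -mulgA].
by exists (h * g^-1)%g; [apply: (LM) => //; exact: LV|rewrite -mulgA mulKg].
Qed.

Let measure_setD_small (A : nat -> set (borel G)) (e : R) :
  (forall n, measurable (A n)) -> (forall m n, (m <= n)%N -> A m `<=` A n) ->
  (forall t, exists n, A n t) -> 0 < e ->
  \forall n \near \oo, (rho (D `\` A n) < e%:E)%E.
Proof.
move=> mA Aincr AT e0.
have : rho (D `\` A n) @[n --> \oo] --> 0%E.
  have -> : 0%E = rho (\bigcap_n (D `\` A n)).
    rewrite (_ : \bigcap_n _ = set0) ?measure0//; apply/seteqP; split => // t cap.
    have [n Ant] := AT t.
    by have [_] := cap n Logic.I; apply.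
  apply: nonincreasing_cvg_mu.
  - apply: le_lt_trans D_finite.
    by apply: le_measure; rewrite ?inE//; exact: measurableD.
  - by move=> n; exact: measurableD.
  - by apply: bigcapT_measurable => n; exact: measurableD.
  - by move=> n k nk; apply/subsetPset; apply: setDS; exact: Aincr.
move=> /fine_cvgP[fin] /cvgrPdist_lt/(_ _ e0).
apply: filterS2 fin => n fin_n /=.
rewrite sub0r normrN ger0_norm ?fine_ge0// => h.
by rewrite -(fineK fin_n) lte_fin.
Qed.

Context (f : X -> R).
Hypotheses (mf : measurable_fun setT f) (fint : mu.-integrable setT (EFin \o f))
  (fH : forall g x, H g -> f (act g x) = f x).

Let I := fine (L1norm mu f).
Let IE : L1norm mu f = I%:E.
Proof.
by rewrite fineK// ge0_fin_numE ?L1norm_ge0//; exact/(L1norm_lty mu mf).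
Qed.
Let I0 : 0 <= I. Proof. by rewrite fine_ge0// L1norm_ge0. Qed.

Let mfact s : measurable_fun setT (fun x => f (act s x)).
Proof. exact: (measurableT_comp mf (mact s)). Qed.

Let L1norm_diff_act (r s : G) :
  (L1norm mu (fun x => (f (act r x) - f (act s x))%R) <= (2 * I)%:E)%E.
Proof.
apply: (@le_trans _ _ (L1norm mu (fun x => f (act r x)) + L1norm mu (fun x => f (act s x)))%E).
  by apply: L1norm_leD => //; [exact: measurable_funB|move=> x; exact: ler_normB].
by rewrite !(L1norm_act act_borel act_mp)// IE -EFinD mulr_natl mulr2n.
Qed.

(** With k = g s v in [K] and g in [H], invariance of [f] gives f(s v x) = f(k x) and f(s x) = f(k
    v^-1 x) = f((k v^-1 k^-1) k x). After the change of variable k x, only the displacement by an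
    element of [U] is left. *)
Let L1norm_diff_close (K : set G) (U : set G) (e : R) (v s : G) :
  (forall u, U u -> (L1norm mu (fun x => (f (act u x) - f x)%R) < e%:E)%E) ->
  (forall k, K k -> U (k * v^-1 * k^-1)%g) ->
  saturation H K (s * v)%g ->
  (L1norm mu (fun x => (f (act (s * v)%g x) - f (act s x))%R) <= e%:E)%E.
Proof.
move=> Ue KU [g Hg Kg]; set k := (g * (s * v))%g in Kg.
rewrite (_ : (fun x => _) = (fun x => f (act k x) - f (act (k * v^-1 * k^-1)%g (act k x)))).
  rewrite (L1norm_act act_borel act_mp k (u := fun y => f y - f (act (k * v^-1 * k^-1)%g y)));
    last exact: measurable_funB.
  by rewrite L1norm_distC ltW// Ue//; exact: KU.
apply/funext => x; rewrite -!(actM act_borel) mulgVK.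
by rewrite /k -!mulgA mulgV mulg1 !(actM act_borel) !(fH _ Hg).
Qed.

Theorem L1norm_orbit_mean_cvg (e : R) : 0 < e ->
  \forall n \near \oo,
    (L1norm mu (fun x => (orbit_mean rho act D f x - lattice_avg act D f (G_ n) x)%R) <= e%:E)%E.
Proof.
(* The final bound is dl + 2 I dl + 2 I dl: closeness on G_0 K, the part of [D] outside G_0 K, and
   the part outside G_n V. *)
move=> e0; pose dl := e / (1 + 4 * I).
have dl0 : 0 < dl by rewrite divr_gt0// ltr_wpDr// mulr_ge0.
have [H1 HM HV] := gG 0%N.
have [Kc [cK KT]] := sG.
pose K j := \big[setU/set0]_(i < j) Kc i.
have cKj j : compact (K j) by exact: bigsetU_compact.
have mK j : measurable (K j : set (borel G)) by exact: compact_measurable_borel.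
have [j HKj] : exists j, (rho (D `\` saturation H (K j)) < dl%:E)%E.
  have [N _ /(_ N (leqnn N)) HN] : \forall j \near \oo, (rho (D `\` saturation H (K j)) < dl%:E)%E.
    apply: measure_setD_small => //.
    - by move=> j; apply: measurable_saturation => //; exact: cG.
    - move=> m n mn t [g Hg Kg]; exists g => //; move: Kg.
      rewrite /K -!bigcup_mkord => -[i /= im Ki]; exists i => //=; exact: leq_trans mn.
    - move=> t; have : (\bigcup_n Kc n) t by rewrite KT.
      move=> [i _ Kit]; exists i.+1; exists 1%g => //.
      by rewrite mul1g /K big_ord_recr/=; right.
  by exists N.
pose U : set G := [set u | (L1norm mu (fun x => (f (act u x) - f x)%R) < dl%:E)%E].
have nU : nbhs (1%g : G) U.
  exact: (integrable_L1_continuous hG sG rho_haar act_borel act_mp mf fint dl0).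
pose V0 : set G := [set v | forall k, K j k -> U (k * v^-1 * k^-1)%g].
have nV0 : nbhs (1%g : G) V0 by exact: near_conjg.
pose V := V0^°.
have oV : open V by exact: open_interior.
have V1 : V 1%g by [].
have mV : measurable (V : set (borel G)) by exact: open_measurable_borel.
have : \forall n \near \oo, (rho (D `\` saturation (G_ n) V) < dl%:E)%E.
  apply: measure_setD_small => //.
  - by move=> n; apply: measurable_saturation => //; case: (gG n).
  - by move=> m n mn t [g Hg Vg]; exists g => //; exact: Gincr Hg.
  (* This is V t^-1, an open set containing t^-1, so it meets the dense union. *)
  - move=> t; pose O := (fun g : G => V (g * t)%g).
    have oO : open O by apply: open_comp => // s _; exact: continuous_mulgr.
    have O0 : O !=set0 by exists t^-1%g; rewrite /O mulVg.
    by have [g [Vg [n _ Gn]]] := Gdense O0 oO; exists n, g.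
apply: filterS => n GVn.
have [F fF] := fG n.
pose HK := saturation H (K j); pose GV := saturation (G_ n) V.
have mHK : measurable HK by apply: measurable_saturation => //; exact: cG.
have mGV : measurable GV by apply: measurable_saturation => //; case: (gG n).
(* w1 pays for the part of D escaping G_0 K, w2 for the part missed by G_n V. *)
pose w1 (t : borel G) : R := dl + 2 * I * \1_(~` HK) t.
pose w2 (t : borel G) : R := 2 * I * \1_(~` GV) t.
have I20 : 0 <= 2 * I by rewrite mulr_ge0.
have J0 (A : set (borel G)) t : 0 <= 2 * I * \1_A t by rewrite mulr_ge0.
have w10 t : 0 <= w1 t by apply: addr_ge0; [exact: ltW|exact: J0].
have w20 t : 0 <= w2 t by exact: J0.
have mw1 : measurable_fun setT w1.
  apply: measurable_funD => //; apply: measurable_funM => //.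
  by apply: measurable_indic; exact: measurableC.
have mw2 : measurable_fun setT w2.
  by apply: measurable_funM => //; apply: measurable_indic; exact: measurableC.
have indic_sat (L A : set G) g t : is_subgroup L -> L g ->
    \1_(~` saturation L A) (g * t)%g = \1_(~` saturation L A) t :> R.
  move=> gL Lg; rewrite !indicE; congr ((_ : bool)%:R).
  apply/idP/idP; rewrite !inE => nA B; apply: nA; move: B.
    by move/(saturationM A t gL Lg).
  by move/(saturationM A t gL Lg).
have w1H g t : H g -> w1 (g * t)%g = w1 t by move=> Hg; rewrite /w1 indic_sat.
have w2G g t : G_ n g -> w2 (g * t)%g = w2 t by move=> Gg; rewrite /w2 indic_sat.
have w1_ge t : saturation H (K j) t \/ (2 * I <= w1 t).
  have [?|nS] := pselect (saturation H (K j) t); first by left.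
  by right; rewrite /w1 indicE mem_set// mulr1 lerDr ltW.
have HGn : H `<=` G_ n by exact: Gincr.
have S_G s : s \in fset_set (G_ n `&` D) -> G_ n s.
  rewrite in_fset_set; first by rewrite inE => -[].
  exact: (finite_lattice_points rho_haar (gG 0%N) (gG n) HGn (cG 0%N) (cG n) fD fF D_finite).
pose w t := (w1 t + w2 t)%:E.
have close (v s : G) : V v ->
    (L1norm mu (fun x => (f (act (s * v)%g x) - f (act s x))%R) <= (w1 (s * v)%g)%:E)%E.
  move=> Vv; have [Sv|Sv] := w1_ge (s * v)%g.
    apply: (@le_trans _ _ dl%:E); last by rewrite lee_fin lerDl J0.
    apply: (L1norm_diff_close (K := K j) (U := U)) => //.
    by have := interior_subset Vv.
  by apply: le_trans (L1norm_diff_act _ _) _; rewrite lee_fin.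
have bound t :
    (L1norm mu (fun x => (lattice_sum act D f (G_ n) (act t x) - lattice_sum act D f (G_ n) x)%R) <=
    \sum_(s <- fset_set (G_ n `&` D)) w (s * t)%g)%E.
  have sumE r :
      (L1norm mu (fun x => (lattice_sum act D f (G_ n) (act r x) - lattice_sum act D f (G_ n) x)%R) <=
      \sum_(s <- fset_set (G_ n `&` D)) L1norm mu (fun x => (f (act (s * r)%g x) - f (act s x))%R))%E.
    rewrite (_ : (fun x => _) =
        (fun x => \sum_(s <- fset_set (G_ n `&` D)) (f (act (s * r)%g x) - f (act s x)))).
      by apply: L1norm_sum => s; exact: measurable_funB.
    apply/funext => x; rewrite sumrB; congr (_ - _).
    by apply: eq_bigr => s _; rewrite (actM act_borel).
  (* By G_n-invariance of the lattice sum, t may be replaced by g t, which lies in [V], so that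
     [close] applies to every summand. *)
  have [[g Gg Vgt]|nGVt] := pselect (GV t).
    rewrite (_ : (fun x => _) =
        (fun x => lattice_sum act D f (G_ n) (act (g * t)%g x) - lattice_sum act D f (G_ n) x)); last first.
      apply/funext => x; rewrite (actM act_borel).
      by rewrite (lattice_sum_act rho_haar act_borel (gG 0%N) (cG 0%N) fD rhoD fH
        (gG n) (cG n) HGn fF (act t x) Gg).
    apply: le_trans (sumE _) _.
    apply: (@le_trans _ _ (\sum_(s <- fset_set (G_ n `&` D)) (w1 (s * (g * t))%g)%:E)%E).
      by apply: lee_sum => s _; exact: close.
    rewrite sumEFin.
    under eq_bigr do rewrite mulgA.
    (* The bounds were obtained at s g t; summed over s, they equal the bounds at s t, since [w1] is
       [H]-invariant and g only permutes the cosets. *)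
    rewrite (sum_lattice_points_mulgr rho_haar (gG 0%N) (gG n) HGn (cG 0%N) (cG n) fD fF
      D_finite (c := fun s => w1 (s * t)%g)) => //.
      rewrite -sumEFin; apply: lee_sum => s _.
      by rewrite lee_fin lerDl w20.
    by move=> h s Hh /=; rewrite -mulgA; exact: w1H.
  (* Outside G_n V each summand gets the crude bound 2 I, which is w2(s t) because s is in [G_ n]
     and [w2] is G_n-invariant. *)
  apply: le_trans (sumE _) _; rewrite big_seq [leRHS]big_seq; apply: lee_sum => s sS.
  apply: le_trans (L1norm_diff_act _ _) _; rewrite lee_fin.
  by rewrite (w2G s t (S_G s sS)) /w2 indicE mem_set// mulr1 lerDr.
apply: (le_trans (L1norm_orbit_mean_avg rho_haar act_borel act_mp (gG 0%N) (cG 0%N)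
  fD rhoD mf fint fH (gG n) (cG n) HGn fF (w := w) _ _ _ (fun t _ => bound t))).
- by apply/measurable_EFinP; exact: measurable_funD.
- by move=> t; rewrite lee_fin addr_ge0.
- by move=> g t Hg; rewrite /w w1H// w2G//; exact: HGn.
have mC (A : set (borel G)) : measurable A -> measurable (~` A) by exact: measurableC.
have int1 (A : set (borel G)) : measurable A ->
    (\int[rho]_(t in D) (2 * I * \1_(~` A) t)%:E = (2 * I)%:E * rho (D `\` A))%E.
  move=> mA; rewrite setDE setIC -integral_indic//; last exact: mC.
  rewrite -ge0_integralZl//; last first.
    by apply/measurable_EFinP; apply: measurable_funTS; apply: measurable_indic; exact: mC.
have mJ (A : set (borel G)) : measurable A ->
    measurable_fun D (fun t : borel G => (2 * I * \1_(~` A) t)%:E).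
  move=> mA; apply/measurable_EFinP; apply: measurable_funTS; apply: measurable_funM => //.
  by apply: measurable_indic; exact: mC.
under eq_integral do rewrite /w /w1 /w2 !EFinD.
rewrite ge0_integralD//; last 4 first.
- by move=> t _; rewrite -EFinD lee_fin addr_ge0// ltW.
- by apply: emeasurable_funD => //; exact: mJ.
- by move=> t _; rewrite lee_fin J0.
- exact: mJ.
rewrite ge0_integralD//; last 3 first.
- by move=> t _; rewrite lee_fin ltW.
- by move=> t _; rewrite lee_fin J0.
- exact: mJ.
rewrite (int1 _ mHK) (int1 _ mGV) (integral_cst rho mD dl%:E) rhoD mule1.
have le2 (A : set (borel G)) : (rho A < dl%:E)%E -> ((2 * I)%:E * rho A <= (2 * I * dl)%:E)%E.
  by move=> Adl; rewrite [leRHS]EFinM; apply: lee_wpmul2l; [rewrite lee_fin|exact: ltW].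
apply: (le_trans (leeD (leeD (lexx _) (le2 _ HKj)) (le2 _ GVn))).
rewrite -!EFinD lee_fin -addrA -mulrDl -[X in X + _]mul1r -mulrDl.
rewrite (_ : 1 + (2 * I + 2 * I) = 1 + 4 * I); last by ring.
by rewrite /dl mulrC divfK// lt0r_neq0// ltr_wpDr// mulr_ge0.
Qed.

End L1_convergence.

(** * Convergence almost everywhere *)

Lemma measurable_superlevel d (X : measurableType d) (R : realType) (u : X -> R) (l : R) :
  measurable_fun setT u -> measurable [set x | l < `|u x|].
Proof.
move=> mu.
rewrite (_ : mkset _ = setT `&` [set x | (l%:E < (`|u x|)%:E)%E]); last first.
  by rewrite setTI; apply/seteqP; split => x /=; rewrite lte_fin.
by apply: emeasurable_fun_lt => //; exact: measurable_abs_EFin.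
Qed.

(** * Maximal inequality and passage from L^1 to almost everywhere convergence *)

Section maximal_inequality.
Context (R : realType) (G : topologicalGroupType) d (X : measurableType d)
  (mu : {measure set X -> \bar R}) (act : G -> X -> X).
Hypotheses (act_borel : borel_action act) (act_mp : measure_preserving_action mu act).
Context (f : X -> R).
Hypotheses (mf : measurable_fun setT f) (fint : mu.-integrable setT (EFin \o f)).

Let mact s := act_measurable act_borel s.

Let mfact s : measurable_fun setT (fun x => f (act s x)).
Proof. exact: (measurableT_comp mf (mact s)). Qed.

Lemma integrable_act s : mu.-integrable setT (fun x => (f (act s x))%:E).
Proof.
apply/(L1norm_lty mu (mfact s)).
by rewrite (L1norm_act act_borel act_mp s mf); exact/(L1norm_lty mu mf).
Qed.

Lemma integrable_bounded_mul (q v : X -> R) : measurable_fun setT q -> (forall x, `|q x| <= 1) ->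
  measurable_fun setT v -> mu.-integrable setT (EFin \o v) ->
  mu.-integrable setT (fun x => (q x * v x)%:E).
Proof.
move=> mq q1 mv iv; apply: (le_integrable measurableT _ _ iv) => //.
  by apply/measurable_EFinP; exact: measurable_funM.
by move=> x _ /=; rewrite lee_fin normrM ler_piMl.
Qed.

(** Since [q] is [L]-invariant, q(x) f(t x) = q(t x) f(t x), and the measure preserving map [act t]
    can be removed from each term. *)
Lemma integral_mul_lattice_avg (D L : set G) (q : X -> R) :
  (0 < #|` fset_set (L `&` D)|)%N -> (forall t, t \in fset_set (L `&` D) -> L t) ->
  measurable_fun setT q -> (forall x, `|q x| <= 1) ->
  (forall g x, L g -> q (act g x) = q x) ->
  (\int[mu]_x (q x * lattice_avg act D f L x)%:E = \int[mu]_x (q x * f x)%:E)%E.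
Proof.
move=> k0 SL mq q1 qL; set S := fset_set _ in k0 SL *.
have iq t : mu.-integrable setT (fun x => (q x * f (act t x))%:E).
  by apply: integrable_bounded_mul => //; exact: integrable_act.
have qf t : t \in S -> (\int[mu]_x (q x * f (act t x))%:E = \int[mu]_x (q x * f x)%:E)%E.
  move=> tS; have := @integral_preserving _ _ _ mu (act t) (mact t) (act_mp t) setT
    (fun x => (q x * f x)%:E) measurableT.
  rewrite preimage_setT => <-; last first.
    by apply/measurable_EFinP; exact: measurable_funM.
  by apply: eq_integral => x _; rewrite qL//; exact: SL.
transitivity (\int[mu]_x ((#|` S|%:R^-1)%:E * \sum_(t <- S) (q x * f (act t x))%:E))%E.
  apply: eq_integral => x _; rewrite sumEFin -EFinM; congr EFin.
  rewrite /lattice_avg /lattice_sum -/S mulrCA; congr (_ * _).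
  by rewrite mulr_sumr.
rewrite integralZl//; last exact: integrable_sum.
rewrite integral_sum// big_seq (eq_bigr (fun=> (\int[mu]_x (q x * f x)%:E)%E)); last first.
  by move=> t; exact: qf.
rewrite -big_seq sume_const_seq muleA -EFinM mulVf ?mul1e//.
by rewrite pnatr_eq0 -lt0n.
Qed.

Lemma integrable_lattice_avg (D L : set G) : mu.-integrable setT (EFin \o lattice_avg act D f L).
Proof.
rewrite (_ : EFin \o _ = (fun x => (#|` fset_set (L `&` D)|%:R^-1)%:E *
    \sum_(t <- fset_set (L `&` D)) (f (act t x))%:E)%E).
  by apply: integrableZl => //; apply: integrable_sum => // t _; exact: integrable_act.
by apply/funext => x /=; rewrite sumEFin -EFinM.
Qed.

Context (G_ : nat -> set G) (D : set G).
Hypotheses (Gincr : forall m n, (m <= n)%N -> G_ m `<=` G_ n)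
  (card_pos : forall n, (0 < #|` fset_set (G_ n `&` D)|)%N)
  (lattice_points : forall n t, t \in fset_set (G_ n `&` D) -> G_ n t).
Let a n := lattice_avg act D f (G_ n).
Hypotheses (a_inv : forall n g x, G_ n g -> a n (act g x) = a n x)
  (ma : forall n, measurable_fun setT (a n)).

Let ia n : mu.-integrable setT (EFin \o a n). Proof. exact: integrable_lattice_avg. Qed.

(** Doob's argument for a reversed martingale: the set is split by the last index n at which l is
    exceeded, and on each piece the integral of |v n| is bounded by that of |v m|. Differences are
    taken with [a M] because it is G_n-invariant for every n <= M, so the pieces and the signs are
    G_n-invariant everywhere. *)
Lemma maximal_lattice_avg (m M : nat) (l : R) : (m <= M)%N -> 0 < l ->
  (l%:E * mu [set x | exists n, (m <= n <= M)%N /\ (l < `|a n x - a M x|)%R] <=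
   L1norm mu (fun x => (a m x - a M x)%R))%E.
Proof.
move=> mM l0; pose v n x := a n x - a M x.
have mv n : measurable_fun setT (v n) by exact: measurable_funB.
have iv n : mu.-integrable setT (EFin \o v n).
  have := integrableB measurableT (ia n) (ia M).
  by apply: eq_integrable => // x _; rewrite /v /= EFinB.
pose C i := [set x | l < `|v (M - i)%N x|].
have mC i : measurable (C i).
  exact: measurable_superlevel.
(* C runs backwards from M: E i is the set where M - i is the last index
   exceeding l, which makes it invariant under G_(M - i). *)
pose E := seqDU C; have mE i : measurable (E i) by exact: seqDU_measurable.
have CM i g x : (i <= M)%N -> G_ (M - i)%N g -> C i (act g x) = C i x.
  move=> iM Gg; rewrite /C /v /= !a_inv//.
  by apply: Gincr Gg; exact: leq_subr.
have EM i g x : (i <= M)%N -> G_ (M - i)%N g -> E i (act g x) = E i x.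
  move=> iM Gg; rewrite /E /seqDU /setD /mkset CM//; congr (_ /\ ~ _).
  rewrite -!bigcup_mkord; apply/propext; split => -[j /= ji Cj]; exists j => //.
    by rewrite -(CM j g)//; [exact: leq_trans (ltnW ji) iM|apply: Gincr Gg; rewrite leq_sub2l// ltnW].
  by rewrite (CM j g)//; [exact: leq_trans (ltnW ji) iM|apply: Gincr Gg; rewrite leq_sub2l// ltnW].
have step i : (i <= M - m)%N ->
    (\int[mu]_(x in E i) l%:E <= \int[mu]_(x in E i) (`|v m x|)%:E)%E.
  move=> iMm; have iM : (i <= M)%N by exact: leq_trans iMm (leq_subr _ _).
  have mn : (m <= M - i)%N by rewrite leq_subCr.
  set n := (M - i)%N in mn.
  (* A bounded G_n-invariant test function with q v_n = |v_n| on [E i]. *)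
  pose q x : R := (-1) ^+ (v n x < 0)%R * \1_(E i) x.
  have mq : measurable_fun setT q.
    apply: measurable_funM; last exact: measurable_indic.
    by apply: (measurableT_comp (f := fun b : bool => (-1) ^+ b : R)) => //; exact: measurable_fun_ltr.
  have q1 x : `|q x| <= 1.
    rewrite normrM normr_sign mul1r indicE.
    by case: (x \in E i); rewrite ?normr1 ?normr0 ?lexx ?ler01.
  have qn g x : G_ n g -> q (act g x) = q x.
    move=> Gg; rewrite /q /v !a_inv//; last by apply: Gincr Gg; exact: leq_subr.
    congr (_ * _); rewrite !indicE; congr ((_ : bool)%:R).
    by apply/idP/idP; rewrite !inE EM.
  have qm k g x : (m <= k)%N -> (k <= n)%N -> G_ k g -> q (act g x) = q x.
    by move=> _ kn Gg; apply: qn; exact: Gincr Gg.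
  (* The right-hand side does not depend on k, so v_n can be exchanged for v_m when paired with
     [q]. *)
  have qv k : (m <= k)%N -> (k <= n)%N -> (\int[mu]_x (q x * v k x)%:E =
      \int[mu]_x (q x * f x)%:E - \int[mu]_x (q x * a M x)%:E)%E.
    move=> mk kn; rewrite -(@integral_mul_lattice_avg D (G_ k) q)//; last 2 first.
    - by move=> t; exact: lattice_points.
    - by move=> g x Gg; exact: (qm k).
    rewrite -integralB//; last 2 first.
    - exact: (integrable_bounded_mul mq q1 (ma k) (ia k)).
    - exact: (integrable_bounded_mul mq q1 (ma M) (ia M)).
    by apply: eq_integral => x _; rewrite -EFinB -mulrBr.
  apply: (@le_trans _ _ (\int[mu]_(x in E i) (`|v n x|)%:E)%E).
    apply: ge0_le_integral => //.
    - by move=> x _; rewrite lee_fin ltW.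
    - by apply: measurable_funTS; exact: measurable_abs_EFin.
    - by move=> x Ex; have Cx : C i x := subset_seqDU Ex; rewrite lee_fin ltW.
  have -> : (\int[mu]_(x in E i) (`|v n x|)%:E = \int[mu]_x (q x * v n x)%:E)%E.
    rewrite integral_mkcond; apply: eq_integral => x _; rewrite /patch /q indicE.
    case: ifPn => xE; last by rewrite mulr0 mul0r.
    by rewrite mulr1 -normrEsign.
  rewrite qv// -(qv m)//.
  rewrite [leRHS]integral_mkcond; apply: le_integral => //.
  - exact: (integrable_bounded_mul mq q1 (mv m) (iv m)).
  - apply/(integrable_mkcond _ (mE i)).
    by apply: (integrableS measurableT) => //; exact: (integrable_abse (iv m)).
  - move=> x _; rewrite /patch /q indicE.
    case: ifPn => xE; last by rewrite mulr0 mul0r.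
    by rewrite mulr1 lee_fin (le_trans (ler_norm _))// normrM normr_sign mul1r.
pose s := index_iota 0 (M - m).+1.
have ZE : [set x | exists n, (m <= n <= M)%N /\ (l < `|a n x - a M x|)%R] =
    \big[setU/set0]_(i <- s) E i.
  rewrite /s big_mkord -bigsetU_seqDU -bigcup_mkord; apply/seteqP; split => x /=.
    move=> [n [/andP[mn nM] ln]]; exists (M - n)%N => /=; first by rewrite ltnS leq_sub2l.
    by rewrite /C /v /= subKn.
  move=> [i /= iMm lx]; exists (M - i)%N; split => //.
  rewrite ltnS in iMm; rewrite leq_subr andbT leq_subCr//.
  exact: leq_trans iMm (leq_subr _ _).
have tE : trivIset [set` s] E by apply: sub_trivIset (trivIset_seqDU C).
have mU : measurable (\big[setU/set0]_(i <- s) E i) by exact: bigsetU_measurable.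
have mabs : measurable_fun setT (fun x => (`|v m x|)%:E) by exact: measurable_abs_EFin.
rewrite ZE -(integral_cst mu mU).
rewrite ge0_integral_bigsetU//; last 2 first.
- exact: iota_uniq.
- by move=> x _; rewrite lee_fin ltW.
apply: (@le_trans _ _ (\sum_(i <- s) \int[mu]_(x in E i) (`|v m x|)%:E)%E).
  rewrite big_seq [leRHS]big_seq; apply: lee_sum => i.
  by rewrite mem_index_iota ltnS => /andP[_]; exact: step.
rewrite -(@ge0_integral_bigsetU _ _ _ mu _ E (fun x => (`|v m x|)%:E) s)//.
- by apply: ge0_subset_integral => // x _; rewrite lee_fin.
- exact: iota_uniq.
- exact: measurable_funTS.
Qed.

Lemma markov_L1norm (u : X -> R) (l : R) : measurable_fun setT u -> 0 < l ->
  (l%:E * mu [set x | (l < `|u x|)%R] <= L1norm mu u)%E.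
Proof.
move=> mu1 l0; have mS := measurable_superlevel l mu1.
rewrite -(integral_cst mu mS).
apply: (@le_trans _ _ (\int[mu]_(x in [set x | (l < `|u x|)%R]) (`|u x|)%:E)%E).
  apply: ge0_le_integral => //.
  - by move=> x _; rewrite lee_fin ltW.
  - by apply: measurable_funTS; exact: measurable_abs_EFin.
  - by move=> x /= /ltW; rewrite lee_fin.
by apply: ge0_subset_integral => //; exact: measurable_abs_EFin.
Qed.

Context (h : X -> R).
Hypotheses (mh : measurable_fun setT h) (h_cvg : forall e : R, 0 < e ->
  \forall n \near \oo, (L1norm mu (fun x => (h x - a n x)%R) <= e%:E)%E).

(** The threshold is doubled to leave l for the distance from [a n] to [a M] and l for that from
    [a M] to [h]. The truncation [ZM] at M is the set to which the maximal inequality applies. *)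
Let Z (l : R) m := [set x | exists n, (m <= n)%N /\ l + l < `|a n x - h x|].

Let ZM (l : R) m M := [set x | exists n, (m <= n <= M)%N /\ l + l < `|a n x - h x|].

Let mZM l m M : measurable (ZM l m M).
Proof.
rewrite (_ : ZM l m M = \bigcup_(n in [set n | (m <= n <= M)%N]) [set x | l + l < `|a n x - h x|]).
  by apply: bigcup_measurable => n _; apply: measurable_superlevel; exact: measurable_funB.
by apply/seteqP; split => [x [n [mn nl]]|x [n mn nl]]; exists n.
Qed.

(** It matters that m does not depend on M, as M tends to infinity afterwards. With tail distances
    to [h] at most e / 4, the maximal inequality costs e / 2 and Markov's inequality for [h] minus
    [a M] costs e / 4. *)
Let measure_ZM (l e : R) : 0 < l -> 0 < e -> exists m, forall M, (l%:E * mu (ZM l m M) <= e%:E)%E.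
Proof.
move=> l0 e0; have e40 : 0 < e / 4 by rewrite divr_gt0.
have [m _ hm] := h_cvg e40; exists m => M.
have [Mm|mM] := ltnP M m.
  rewrite (_ : ZM l m M = set0) ?measure0 ?mule0 ?lee_fin ?ltW//.
  apply/seteqP; split => // x [n [/andP[mn nM]]].
  by move: (leq_trans mn nM); rewrite leqNgt Mm.
have mhn n : measurable_fun setT (fun x => h x - a n x) by exact: measurable_funB.
have mA : measurable [set x | exists n, (m <= n <= M)%N /\ (l < `|a n x - a M x|)%R].
  rewrite (_ : mkset _ = \bigcup_(n in [set n | (m <= n <= M)%N]) [set x | l < `|a n x - a M x|]).
    by apply: bigcup_measurable => n _; apply: measurable_superlevel; exact: measurable_funB.
  by apply/seteqP; split => [x [n [mn nl]]|x [n mn nl]]; exists n.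
have mB : measurable [set x | l < `|h x - a M x|] by exact: measurable_superlevel.
apply: (@le_trans _ _ (l%:E * mu [set x | exists n, (m <= n <= M)%N /\ (l < `|a n x - a M x|)%R] +
    l%:E * mu [set x | (l < `|h x - a M x|)%R])%E).
  rewrite -ge0_muleDr ?measure_ge0//; apply: lee_wpmul2l; first by rewrite lee_fin ltW.
  apply: le_trans (measureU2 _ mA mB).
  apply: le_measure; rewrite ?inE//; first exact: measurableU.
  move=> x [n [mn ln]].
  have [lt1|ge1] := ltP l `|a n x - a M x|; first by left; exists n.
  have [lt2|ge2] := ltP l `|h x - a M x|; first by right.
  move: ln; rewrite ltNge => /negP; case.
  by rewrite (le_trans (ler_distD (a M x) _ _))// lerD// distrC.
have aM : (L1norm mu (fun x => (a m x - a M x)%R) <= (e / 4 + e / 4)%:E)%E.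
  apply: (@le_trans _ _ (L1norm mu (fun x => (h x - a m x)%R) + L1norm mu (fun x => (h x - a M x)%R))%E).
    apply: L1norm_leD => //; first exact: measurable_funB.
    by move=> x; rewrite (distrC (h x) (a m x)); exact: ler_distD.
  by rewrite EFinD; apply: leeD; apply: hm => //=.
apply: (@le_trans _ _ ((e / 4 + e / 4)%:E + (e / 4)%:E)%E).
  apply: leeD; first exact: le_trans (maximal_lattice_avg mM l0) aM.
  exact: le_trans (markov_L1norm (mhn M) l0) (hm _ mM).
by rewrite -EFinD lee_fin; lra.
Qed.

Let ZE l m : Z l m = \bigcup_M ZM l m M.
Proof.
apply/seteqP; split => [x [n [mn ln]]|x [M _ [n [/andP[mn _] ln]]]]; last by exists n.
by exists n => //; exists n; rewrite mn leqnn.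
Qed.

Let mZ l m : measurable (Z l m).
Proof. by rewrite ZE; exact: bigcupT_measurable. Qed.

Let measure_Z (l e : R) : 0 < l -> 0 < e -> exists m, (mu (Z l m) <= (l^-1 * e)%:E)%E.
Proof.
move=> l0 e0; have [m hm] := measure_ZM l0 e0; exists m.
have cvgZ : mu (ZM l m M) @[M --> \oo] --> mu (Z l m).
  rewrite ZE; apply: nondecreasing_cvg_mu => //; first by rewrite -ZE.
  move=> M M' MM'; apply/subsetPset => x [n [/andP[mn nM] ln]]; exists n; split => //.
  by rewrite mn (leq_trans nM).
rewrite -(cvg_lim (@ereal_hausdorff R) cvgZ); apply: lime_le.
  by apply/cvg_ex; exists (mu (Z l m)).
by apply: nearW => M; rewrite EFinM lee_pdivlMl.
Qed.

Theorem ae_cvg_lattice_avg : \forall x \ae mu, a n x @[n --> \oo] --> h x.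
Proof.
(* The points where |a n x - h x| exceeds 2 / (j + 1) for infinitely many n. *)
pose N j := \bigcap_m Z (j.+1%:R^-1) m.
have N0 j : mu.-negligible (N j).
  have l0 : 0 < j.+1%:R^-1 :> R by rewrite invr_gt0.
  have mN : measurable (N j) by exact: bigcapT_measurable.
  apply/negligibleP => //; apply/eqP; rewrite -measure_le0; apply/lee_addgt0Pr => e e0.
  have el0 : 0 < j.+1%:R^-1 * e by rewrite mulr_gt0.
  have [m hm] := measure_Z l0 el0; rewrite add0e.
  apply: (@le_trans _ _ (mu (Z j.+1%:R^-1 m))).
    by apply: le_measure; rewrite ?inE//; exact: bigcap_inf.
  by apply: le_trans hm _; rewrite lee_fin mulrA mulVf ?mul1r// invr_eq0.
have := negligible_bigcup N0; apply: negligibleS => x nx; apply: contrapT => nN; apply: nx.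
apply/cvgrPdist_le => e e0.
(* Then j + 1 > 2 / e, so the threshold 2 / (j + 1) is at most e. *)
pose j := Num.truncn (2 / e).
have je : j.+1%:R^-1 + j.+1%:R^-1 <= e.
  rewrite -mulr2n -(mulr_natl _ 2) ler_pdivrMr// mulrC -ler_pdivrMr// ltW//.
  exact: truncnS_gt.
have nNj : ~ N j x by move=> Nj; apply: nN; exists j.
have [m nZ] : exists m, ~ Z j.+1%:R^-1 m x.
  by apply: contrapT => allZ; apply: nNj => m _; apply: contrapT => nZ; apply: allZ; exists m.
exists m => // n /= mn; rewrite distrC; apply: le_trans je.
by rewrite leNgt; apply/negP => lt; apply: nZ; exists n.
Qed.

End maximal_inequality.

(** * From almost everywhere to strict invariance under G_0, and back *)

Section strict_invariance.
Context (R : realType) (G : topologicalGroupType) (rho : {measure set (borel G) -> \bar R})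
  d (X : measurableType d) (mu : {sigma_finite_measure set X -> \bar R}) (act : G -> X -> X).
Hypotheses (act_borel : borel_action act) (act_mp : measure_preserving_action mu act).

(** Used to transfer the averages from the modified function back to [f]: they evaluate it only
    along a countable part of the orbit of x. *)
Lemma ae_countable_orbit_notin (L : set G) (N : set X) :
  countable L -> L 1%g -> measurable N -> mu N = 0%E ->
  \forall x \ae mu, forall t, L t -> ~ N (act t x).
Proof.
move=> cL L1 mN N0; have [e eL] := countable_enum cL L1.
have : mu.-negligible (\bigcup_i act (e i) @^-1` N).
  apply: negligible_bigcup => i; apply/negligibleP; last exact: etrans (act_mp _ mN) N0.
  by rewrite -[X in measurable X]setTI; exact: act_measurable.
apply: negligibleS => x /= nx; apply: contrapT => nN; apply: nx => t.
by rewrite -eL => -[i _ <-] Nt; apply: nN; exists i.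
Qed.

(** The counterpart for the integral over [D]. Uncountably many t occur, so a union of null sets is
    replaced by Tonelli applied to the indicator of the pairs (t, x) with t x in [N]. *)
Lemma ae_ae_orbit_notin (D : set (borel G)) (N : set X) :
  measurable D -> (rho D < +oo)%E -> measurable N -> mu N = 0%E ->
  \forall x \ae mu, {ae rho, forall t, D t -> ~ N (act t x)}.
Proof.
move=> mD Dfin mN N0.
pose phi (p : borel G * X) : \bar R := (\1_N (act p.1 p.2))%:E.
have mphi : measurable_fun setT phi.
  apply/measurable_EFinP; apply: (measurableT_comp (measurable_indic _)) => //.
  exact: act_measurable2.
have phi0 p : (0 <= phi p)%E by rewrite lee_fin.
have mI := measurable_integral_restr mD Dfin mphi phi0.
have : (\int[mu]_x `|\int[rho]_(t in D) phi (t, x)| = 0)%E.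
  under eq_integral do rewrite gee0_abs ?integral_ge0//.
  rewrite -(tonelli_restr mu mD Dfin mphi phi0).
  rewrite integral0_eq// => t _.
  have mP : measurable (act t @^-1` N).
    by rewrite -[X in measurable X]setTI; exact: act_measurable.
  transitivity (mu (act t @^-1` N `&` setT)).
    rewrite -(integral_indic mu measurableT mP); apply: eq_integral => x _.
    by rewrite /phi !indicE; congr (_%:R%:E); apply/idP/idP; rewrite !inE.
  by rewrite setIT; exact: etrans (act_mp t mN) N0.
move=> /(ae_eq_integral_abs mu measurableT mI); apply: filterS => x /(_ Logic.I) /= Ix.
have mphix : measurable_fun setT (fun t : borel G => phi (t, x)).
  exact: (measurableT_comp mphi (@pair2_measurable _ _ (borel G) X x)).
have : (\int[rho]_(t in D) `|phi (t, x)| = 0)%E.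
  by rewrite -[RHS]Ix; apply: eq_integral => t _; rewrite gee0_abs.
move=> /(ae_eq_integral_abs rho mD (measurable_funTS mphix)); apply: filterS => t /[apply].
by rewrite /phi /= indicE => /eqP + Nt; rewrite mem_set// eqe oner_eq0.
Qed.

(** The x at which f(h x) = f(x) for all h in [H] form an [H]-invariant set, of null complement as
    [H] is countable. Setting [f] to 0 on that complement makes invariance hold everywhere. *)
Lemma strictly_invariant_version (H : set G) (f : X -> R) :
  is_subgroup H -> countable H -> measurable_fun setT f ->
  (forall t, H t -> \forall x \ae mu, f (act t x) = f x) ->
  exists (f' : X -> R) (N : set X), [/\ measurable_fun setT f', (forall x, `|f' x| <= `|f x|),
    (forall g x, H g -> f' (act g x) = f' x), measurable N /\ mu N = 0%E &
    forall x, ~ N x -> f' x = f x].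
Proof.
move=> [H1 HM HV] cH mf finv; have [e eH] := countable_enum cH H1.
have mfact s : measurable_fun setT (fun x => f (act s x)).
  exact: (measurableT_comp mf (act_measurable act_borel s)).
(* Inequality of the two values is written as a superlevel set so that [measurable_superlevel]
   applies. *)
pose N := \bigcup_i [set x | 0 < `|f (act (e i) x) - f x|].
have mN : measurable N.
  apply: bigcupT_measurable => i; apply: measurable_superlevel.
  exact: measurable_funB.
have N0 : mu N = 0%E.
  apply/negligibleP => //; apply: negligible_bigcup => i.
  have Hei : H (e i) by rewrite -eH; exists i.
  apply: negligibleS (finv _ Hei) => x /= h fe.
  by move: h; rewrite fe subrr normr0 ltxx.
have NP x : ~ N x -> forall g, H g -> f (act g x) = f x.
  move=> nN g; rewrite -eH => -[i _ <-]; apply/eqP; rewrite -subr_eq0 -normr_eq0.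
  by apply: contra_notT nN => ne; exists i => //=; rewrite normr_gt0 -normr_eq0.
have NH x g : H g -> ~ N x -> ~ N (act g x).
  move=> Hg nN [i _ /=]; rewrite -(actM act_borel) (NP x nN)// ?(NP x nN)//.
    by rewrite subrr normr0 ltxx.
  by apply: HM => //; rewrite -eH; exists i.
exists (fun x => f x * \1_(~` N) x), N; split => //.
- by apply: measurable_funM => //; apply: measurable_indic; exact: measurableC.
- move=> x; rewrite normrM indicE ler_piMr//.
  by case: (x \in _); rewrite ?normr1 ?normr0.
- move=> g x Hg; rewrite !indicE; have [Nx|nN] := pselect (N x).
    have Ngx : N (act g x).
      apply: contrapT => /(NH _ _ (HV _ Hg)).
      by rewrite -(actM act_borel) mulVg (act1 act_borel).
    by rewrite !memNset ?mulr0//= => -[].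
  by rewrite !mem_set ?mulr1 ?NP//; exact: NH.
- by move=> x nN; rewrite indicE mem_set// mulr1.
Qed.

End strict_invariance.

Theorem theorem3p18 (R : realType)
  (G : topologicalGroupType)
  (G_hausdorff : hausdorff_space G)
  (G_locally_compact : locally_compact [set: G])
  (G_sigma_compact : sigma_compact G)
  (rho : {measure set (borel G) -> \bar R})
  (rho_haar : haar_measure rho)
  (G_ : nat -> set G)
  (G_lattice : forall n, is_lattice rho (G_ n))
  (G_increasing : forall m n, (m <= n)%N -> G_ m `<=` G_ n)
  (G_dense : dense (\bigcup_n G_ n))
  (D : set (borel G))
  (D_fundamental : fundamental_domain (G_ 0%N) D)
  (rho_D : rho D = 1%E)
  (d : measure_display) (X : measurableType d)
  (X_standard : standard_borel R X)
  (mu : {sigma_finite_measure set X -> \bar R})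
  (act : G -> X -> X)
  (act_borel : borel_action act)
  (act_preserving : measure_preserving_action mu act)
  (f : X -> R)
  (f_integrable : mu.-integrable setT (EFin \o f))
  (f_invariant : forall t, G_ 0%N t -> \forall x \ae mu, f (act t x) = f x) :
  (forall n, finite_set (G_ n `&` D)) /\
  \forall x \ae mu,
    rho.-integrable D (fun t => (f (act t x))%:E) /\
    ((#|` fset_set (G_ n `&` D)|%:R)^-1 *
      \sum_(t \in G_ n `&` D) f (act t x)) @[n --> \oo]
    --> \int[rho]_(t in D) f (act t x).
Proof.
have gG n : is_subgroup (G_ n) by case: (G_lattice n).
have cG n : countable (G_ n).
  by have [? ? _] := G_lattice n; exact: discrete_subgroup_countable.
have fG n : exists F : set (borel G), fundamental_domain (G_ n) F.
  by have [_ _ [F ? _]] := G_lattice n; exists F.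
have G0 n : G_ 0%N `<=` G_ n by exact: G_increasing.
have [mD _] := D_fundamental.
have D_finite : (rho D < +oo)%E by rewrite rho_D ltry.
have finS n : finite_set (G_ n `&` D).
  have [F fF] := fG n.
  exact: (finite_lattice_points rho_haar (gG 0%N) (gG n) (G0 n) (cG 0%N) (cG n) D_fundamental fF).
split => //.
have mf : measurable_fun setT f by apply/measurable_EFinP; case/integrableP: f_integrable.
have [f' [N [mf' f'f f'H [mN N0] f'E]]] :=
  strictly_invariant_version act_borel (gG 0%N) (cG 0%N) mf f_invariant.
have if' : mu.-integrable setT (EFin \o f').
  apply: (le_integrable measurableT _ _ f_integrable); first exact/measurable_EFinP.
  by move=> x _ /=; rewrite lee_fin.
have ae_orbit := ae_integrable_orbit act_borel act_preserving D_fundamental rho_D mf' if'.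
have ae_cvg : \forall x \ae mu, lattice_avg act D f' (G_ n) x @[n --> \oo] -->
    orbit_mean rho act D f' x.
  apply: (ae_cvg_lattice_avg act_borel act_preserving mf' if' G_increasing).
  - move=> n; have [F fF] := fG n.
    exact: (lattice_points_gt0 rho_haar (gG 0%N) (cG 0%N) D_fundamental rho_D (gG n) (cG n) (G0 n) fF).
  - by move=> n t; rewrite in_fset_set// inE => -[].
  - move=> n g x; have [F fF] := fG n.
    exact: (lattice_avg_act rho_haar act_borel (gG 0%N) (cG 0%N) D_fundamental rho_D f'H
      (gG n) (cG n) (G0 n) fF).
  - by move=> n; exact: measurable_lattice_avg.
  - exact: (measurable_orbit_mean act_borel D_fundamental rho_D mf').
  - move=> e; exact: (L1norm_orbit_mean_cvg G_hausdorff G_sigma_compact rho_haar act_borel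
      act_preserving gG cG G_increasing G_dense fG D_fundamental rho_D mf' if' f'H).
(* Everything is now known for [f']. It remains to see that, for almost every x, neither the
   averages nor the integral over [D] notice the set [N] where [f'] may differ from [f]. *)
have ae_notin n : \forall x \ae mu, forall t, G_ n t -> ~ N (act t x).
  by apply: (ae_countable_orbit_notin act_borel act_preserving (cG n)) => //; case: (gG n).
have ae_notinT : \forall x \ae mu, forall n t, G_ n t -> ~ N (act t x).
  exact: ae_foralln.
have ae_D := ae_ae_orbit_notin act_borel act_preserving mD D_finite mN N0.
have ae_N : \forall x \ae mu, (forall n t, G_ n t -> ~ N (act t x)) /\
    {ae rho, forall t, D t -> ~ N (act t x)}.
  by apply: filterS2 ae_notinT ae_D => x.
apply: filterS3 ae_orbit ae_cvg ae_N => x ix cx [nNx nDx].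
have mt (g : X -> R) : measurable_fun setT g -> measurable_fun D (fun t : borel G => (g (act t x))%:E).
  move=> mg; apply/measurable_EFinP; apply: measurable_funTS.
  apply: (measurableT_comp mg).
  exact: (measurableT_comp (act_measurable2 act_borel) (@pair2_measurable _ _ (borel G) X x)).
have fE : ae_eq rho D (fun t => (f' (act t x))%:E) (fun t => (f (act t x))%:E).
  by apply: filterS nDx => t nN Dt; rewrite f'E//; exact: nN.
have DE : (\int[rho]_(t in D) f (act t x) = orbit_mean rho act D f' x)%R.
  rewrite /orbit_mean /Rintegral; congr fine; apply/esym/ae_eq_integral => //; exact: mt.
split.
  apply/integrableP; split; first exact: mt.
  case/integrableP: ix => _; rewrite (ae_eq_integral (fun t : borel G => `|(f (act t x))%:E|%E))//.
  - by apply: measurableT_comp => //; exact: mt.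
  - by apply: measurableT_comp => //; exact: mt.
  - by apply: filterS fE => t /[apply] ->.
rewrite DE; apply: cvg_trans cx; apply: near_eq_cvg; apply: nearW => n.
rewrite /lattice_avg /lattice_sum fsbig_finite//=; congr (_ * _).
rewrite big_seq [RHS]big_seq; apply: eq_bigr => t.
by rewrite in_fset_set// inE => -[Gt _]; rewrite f'E//; exact: nNx Gt.
Qed.
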